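(* Let $\mathcal{F}(dr)$ be a finite measure on $(0,\infty)$ and let $(z_t(r),r_t)_{t\ge 0,\ r>0}$ be a family of trajectories and radii satisfying the assumptions listed in the context. Then the associated sea spray process $\mathcal{S}_t(z)$ is a stationary stochastic process (in the time variable $t$) with mean value function $$m(z)=E[\mathcal{S}_t(z)]=\tfrac{4}{3}\pi\rho\int_0^\infty\int_0^\infty r_s^3\,1_{(0,z]}(z_s(r))\,\mathcal{F}(dr)\,ds ,$$ and covariance function $$\sigma^2(t,z;s,w)=E\big([\mathcal{S}_t(z)-m(z)]\cdot[\mathcal{S}_s(w)-m(w)]\big)$$ $$=\tfrac{16}{9}\pi^2\rho^2\int_0^\infty\int_0^\infty r^3_{t-s\wedge t+u}\,r^3_{s-s\wedge t+u}\,1_{(0,z]}(z_{t-s\wedge t+u}(r))\,1_{(0,w]}(z_{s-s\wedge t+u}(r))\,\mathcal{F}(dr)\,du .$$ In particular, the equal-time covariance is $$\sigma^2(t,z;t,w)=\tfrac{16}{9}\pi^2\rho^2\int_0^\infty\int_0^\infty r_u^6\,1_{(0,z\wedge w]}(z_u(r))\,\mathcal{F}(dr)\,du .$$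
   Context: Notation: $a\wedge b$ is the smaller of $a$ and $b$, and $1_A$ is the indicator function of the set $A$. In expressions such as $t-s\wedge t+u$ the minimum is taken first: $t-(s\wedge t)+u$. The constant $\rho$ is the mass density of sea water. Trajectories and radii: for each fixed $r>0$, $(z_t(r),r_t)$ is a pair of nonnegative functions of $t\ge 0$ with $r_0=r$ and $z_0(r)=0$ (the function $r_t$ depends on the initial radius $r$, which is suppressed in the notation). The duration of the droplet is $\zeta=\zeta(r)=\inf\{t>0\mid z_t(r)=0\text{ or }r_t=0\}$. Assumptions: (i) $r_t$ and $z_t(r)$ are continuous in $t$ on $[0,\zeta]$; (ii) if $r_t=0$ for some $t>0$ then $r_s=0$ and $z_s(r)=0$ for all $s\ge t$; (iii) if $z_t(r)=0$ for some $t>0$ then $z_s(r)=0$ and $r_s=0$ for all $s\ge t$. Sea spray process: let $\mathcal{N}$ be the Poisson point process whose points are pairs $(r,s)$ (initial radius $r\in(0,\infty)$, ejection time $s\in\mathbb{R}$) and whose intensity measure is $\Lambda(dr\,ds)=\mathcal{F}(dr)\,ds$. For $t\in\mathbb{R}$ and $z>0$, $$\mathcal{S}_t(z)=\tfrac{4}{3}\pi\rho\int_{-\infty}^t\int_0^\infty r_{t-s}^3\,1_{(0,z]}(z_{t-s}(r))\,\mathcal{N}(dr\,ds),$$ the total mass of airborne droplets at height at most $z$ at time $t$. All integrals defining the process are integrals of nonnegative functions with respect to nonnegative measures and are permitted to take infinite values.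
   Formalization: The covariance formulas are stated when the means m(z) and m(w) are finite (otherwise S−m may be ∞−∞ and the covariance is undefined or the formula fails); measurability of z_t(r) and r_t in r, tacit in the integrals, is made explicit. *)

(* Defs.v *)
From HB Require Import structures.
From mathcomp Require Import all_boot all_order all_algebra.
From mathcomp Require Import all_classical all_reals all_analysis.
From mathcomp Require Import measurable_realfun.
Import Order.TTheory GRing.Theory Num.Theory.
Import numFieldNormedType.Exports.

Set Implicit Arguments.
Unset Strict Implicit.
Unset Printing Implicit Defensive.

Local Open Scope classical_set_scope.
Local Open Scope ring_scope.

(* A random measure on E is a kernel from the sample space to E; a point process
   is one that takes values in the extended natural numbers.  [poisson_prob] is
   used rather than [poisson_pmf], which is not a mass function at rate 0; the
   second argument of [poisson_prob] is a dummy. *)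
Record poisson_point_process d d' (Omega : measurableType d)
    (E : measurableType d') (R : realType) (P : probability Omega R)
    (Lambda : set E -> \bar R) (N : R.-ker Omega ~> E) : Prop := {
  ppp_integer : forall (o : Omega) (A : set E), measurable A ->
    N o A = +oo%E \/ exists k : nat, N o A = k%:R%:E ;
  ppp_poisson : forall A : set E, measurable A -> (Lambda A < +oo)%E ->
    forall k : nat, P [set o | N o A = k%:R%:E] =
      poisson_prob (fine (Lambda A)) 0 [set k] ;
  ppp_infinite : forall A : set E, measurable A -> Lambda A = +oo%E ->
    P [set o | N o A = +oo%E] = 1%E ;
  ppp_independent : forall (n : nat) (A : 'I_n -> set E)
      (B : 'I_n -> set (\bar R)),
    (forall i, measurable (A i)) -> trivIset [set: 'I_n] A ->
    (forall i, measurable (B i)) ->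
    P (\bigcap_(i in [set: 'I_n]) [set o | B i (N o (A i))]) =
      (\prod_(i < n) P [set o | B i (N o (A i))])%E }.

(* The infimum of the empty set is +oo. *)
Definition duration (R : realType) (z q : R -> R) : \bar R :=
  ereal_inf (EFin @` [set t : R | 0 < t /\ (z t = 0 \/ q t = 0)]).

(* [z t] is the height and [q t] the radius at age [t] of a droplet of initial
   radius [r]; values at negative ages are irrelevant. *)
Record droplet (R : realType) (r : R) (z q : R -> R) : Prop := {
  droplet_height_ge0 : forall t : R, 0 <= t -> 0 <= z t ;
  droplet_radius_ge0 : forall t : R, 0 <= t -> 0 <= q t ;
  droplet_height0 : z 0 = 0 ;
  droplet_radius0 : q 0 = r ;
  droplet_height_continuous :
    {within [set t : R | 0 <= t /\ (t%:E <= duration z q)%E], continuous z} ;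
  droplet_radius_continuous :
    {within [set t : R | 0 <= t /\ (t%:E <= duration z q)%E], continuous q} ;
  droplet_evaporated : forall t : R, 0 < t -> q t = 0 ->
    forall s : R, t <= s -> q s = 0 /\ z s = 0 ;
  droplet_landed : forall t : R, 0 < t -> z t = 0 ->
    forall s : R, t <= s -> z s = 0 /\ q s = 0 }.

(* Arguments of [hgt] and [rad]: initial radius, then age.  Measurability in the
   initial radius at each age, together with the continuity in the age, makes
   the integrands below jointly measurable. *)
Record droplet_family (R : realType) (hgt rad : R -> R -> R) : Prop := {
  family_droplet : forall r : R, 0 < r -> droplet r (hgt r) (rad r) ;
  family_height_measurable : forall t : R, 0 <= t ->
    measurable_fun (`]0, +oo[ : set R) (fun r : R => hgt r t) ;
  family_radius_measurable : forall t : R, 0 <= t ->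
    measurable_fun (`]0, +oo[ : set R) (fun r : R => rad r t) }.

(* The points of [nu] are pairs (initial radius, ejection time). *)
Definition sea_spray (R : realType) (rho : R) (hgt rad : R -> R -> R)
    (nu : set (measurableTypeR R * measurableTypeR R) -> \bar R) (t z : R)
    : \bar R :=
  ((4 / 3 * pi * rho)%:E *
    \int[nu]_(p in `]0%R, +oo[ `*` `]-oo, t])
      (rad p.1 (t - p.2) ^+ 3 * \1_`]0, z] (hgt p.1 (t - p.2)))%:E)%E.

(* Strict stationarity in the first argument of the process of functions
   [X t] on ]0, +oo[: each [X t z] is a random variable and the joint law of
   finitely many of them is invariant under a common time shift. *)
Record stationary_process d (Omega : measurableType d) (R : realType)
    (P : probability Omega R) (X : R -> R -> Omega -> \bar R) : Prop := {
  stationary_measurable : forall t z : R, 0 < z ->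
    measurable_fun [set: Omega] (X t z) ;
  stationary_shift : forall (n : nat) (t z : 'I_n -> R) (h : R),
    (forall i, 0 < z i) ->
    forall B : set (n.-tuple (\bar R)), measurable B ->
    P [set o | B [tuple X (t i + h) (z i) o | i < n]] =
    P [set o | B [tuple X (t i) (z i) o | i < n]] }.

(* Main.v *)
(* Put f(r, v) = c * (mass at time t, below height z, of a droplet of initial
   radius r ejected at time v), so that S_t(z) is the integral of f against N.
   The Poisson moments of N A and N B give E[N A * N B] = L(A & B) + L A * L B
   for the intensity L, in [0, +oo]; extending this from sets to functions
   yields Campbell's formulas E[N f] = L f and E[N f * N g] = L (f g) + L f * L g.
   Since m(z) is finite, subtracting the means leaves L (f g), and the
   reflection v |-> t - v turns the integrals against L into the stated ones.
   For stationarity, the law of a Poisson process on the space of measures is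
   determined by its intensity (split finitely many sets into disjoint atoms),
   and L is invariant under time shifts.  The integrands are jointly measurable
   because trajectories are left-continuous in the age. *)

Require Import Defs.
From HB Require Import structures.
From mathcomp Require Import all_boot all_order all_algebra.
From mathcomp Require Import all_classical all_reals all_analysis.
From mathcomp Require Import measurable_realfun ring lra.
Import Order.TTheory GRing.Theory Num.Theory.
Import numFieldNormedType.Exports.

Local Open Scope classical_set_scope.
Local Open Scope ring_scope.

(** The identities live in [0, +oo]: the intensity of the whole space is infinite unless F vanishes,
    and L (f g) can be +oo although the means are finite. Nor is [N o] assumed sigma-finite, so
    E[N f * N g] is not unfolded by Fubini; one argument is extended from sets to functions at a
    time, while the other is frozen as a weight. The right-hand sides have the same shape. Since L
    (A & B) is the integral over A of the Dirac mass of B, each of them is a weighted integral of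
    the kernel of Dirac masses, with weight 1 for the mean, then 1_B + L B, then f + L f. One
    transfer principle thus serves three times. The detour through the space of measures is forced
    by S_t(z) depending on N through an integral, which no finite family of sets determines.
    Equality in law is obtained for finitely many counts, extended to the sigma-algebra generated by
    all counts, and only then applied to integrals, which are measurable for it. *)

(** * Passing from sets to functions in weighted integrals of kernels *)

Lemma nondecreasing_cvgeZl {R : realType} (u : (\bar R)^nat) (c l : \bar R) :
  (0 <= c)%E -> (forall n, 0 <= u n)%E -> nondecreasing_seq u ->
  u @ \oo --> l -> (fun n => c * u n)%E @ \oo --> (c * l)%E.
Proof.
move=> c0 u0 ndu ul.
have ul' n : (u n <= l)%E.
  rewrite -(cvg_lim _ ul)//.
  by apply: lime_ge => //; [exact: cvgP ul|near=> m; apply: ndu; near: m; exists n].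
(* Multiplication by +oo is not continuous at 0. Monotonicity saves the limit: either every [u n] is
   0, or some [u n] is positive and the product is +oo from there on. *)
case: c c0 => [r r0|_|//]; first exact: cvgeZl.
have l0 : (0 <= l)%E by exact: le_trans (u0 0%N) (ul' 0%N).
have [l_eq0|l_gt0] := eqVneq l 0%E.
  suff -> : (fun n => +oo * u n)%E = cst (+oo * l)%E by exact: cvg_cst.
  apply/funext => n /=; congr (_ * _)%E.
  by apply/eqP; rewrite eq_le ul' l_eq0 u0.
apply: cvg_near_cst.
have [n un] : exists n, (0 < u n)%E.
  apply: contrapT => /forallNP un; move: l_gt0; rewrite -(cvg_lim _ ul)//.
  suff -> : u = cst 0%E by rewrite lim_cst// eqxx.
  apply/funext => n /=; apply/eqP; rewrite eq_le u0 andbT leNgt.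
  exact/negP/un.
near=> m; rewrite (@gt0_mulye _ l) ?gt0_mulye //; last by rewrite lt0e l_gt0.
by rewrite (lt_le_trans un)//; apply: ndu; near: m; exists n.
Unshelve. all: by end_near. Qed.

Section integral_weighted_kernel.
Context d d' (X : measurableType d) (E : measurableType d') (R : realType).
Variables (mu : {measure set X -> \bar R}) (W : X -> \bar R).
Variable kappa : X -> {measure set E -> \bar R}.
Hypotheses (W0 : forall x, (0 <= W x)%E) (mW : measurable_fun [set: X] W).
Hypothesis mkappa : forall A, measurable A ->
  measurable_fun [set: X] (kappa ^~ A).
Local Open Scope ereal_scope.

Import HBNNSimple.

Lemma integral_weighted_kernel_nnsfun (f : {nnsfun E >-> R}) :
  \int[mu]_x (W x * \int[kappa x]_e (f e)%:E) =
  \sum_(r \in range f) (r%:E * \int[mu]_x (W x * kappa x (f @^-1` [set r]))).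
Proof.
under eq_integral.
  move=> x _; rewrite integralT_nnsfun sintegralE.
  rewrite ge0_mule_fsumr; last by move=> r; exact: nnsfun_mulemu_ge0.
  over.
have mWk r : measurable_fun setT (fun x => W x * kappa x (f @^-1` [set r])).
  by apply: emeasurable_funM => //; exact: mkappa.
rewrite ge0_integral_fsum//; last 2 first.
- by move=> r; apply: emeasurable_funM => //; apply: measurable_funeM; exact: mkappa.
- by move=> r x _; rewrite mule_ge0//; exact: nnsfun_mulemu_ge0.
apply: eq_fsbigr => r; rewrite inE => -[e _ <-].
under eq_integral do rewrite muleCA.
by rewrite ge0_integralZl// ?lee_fin// => x _; rewrite mule_ge0.
Qed.

(** Monotone convergence twice: in [e] under the kernel, then in [x]. The weight may be infinite
    between the two. *)
Lemma cvg_integral_weighted_kernel (f : E -> \bar R)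
    (mf : measurable_fun [set: E] f) : (forall e, 0 <= f e) ->
  (fun n => \int[mu]_x
    (W x * \int[kappa x]_e (nnsfun_approx measurableT mf n e)%:E)) @ \oo -->
  \int[mu]_x (W x * \int[kappa x]_e f e).
Proof.
move=> f0; pose f_ := nnsfun_approx measurableT mf.
pose g n x := W x * \int[kappa x]_e (f_ n e)%:E.
have f_0 n x : 0 <= \int[kappa x]_e (f_ n e)%:E.
  by apply: integral_ge0 => e _; rewrite lee_fin.
have ndf x : nondecreasing_seq (fun n => \int[kappa x]_e (f_ n e)%:E).
  move=> a b ab; apply: ge0_le_integral => //.
  - by move=> e _; rewrite lee_fin.
  - exact/measurable_EFinP.
  - exact/measurable_EFinP.
  - by move=> e _; rewrite lee_fin; exact/lefP/nd_nnsfun_approx.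
have cvgg x : g ^~ x @ \oo --> W x * \int[kappa x]_e f e.
  apply: nondecreasing_cvgeZl => //.
  rewrite (_ : \int[kappa x]_e f e =
      \int[kappa x]_e limn (fun n => (f_ n e)%:E)).
    apply: cvg_monotone_convergence => //.
    - by move=> n; exact/measurable_EFinP.
    - by move=> n e _; rewrite lee_fin.
    - by move=> e _ a b ab; rewrite lee_fin; exact/lefP/nd_nnsfun_approx.
  by apply: eq_integral => e _; apply/esym/cvg_lim => //; exact: cvg_nnsfun_approx.
rewrite (_ : \int[mu]_x _ = \int[mu]_x limn (g ^~ x)); last first.
  by apply: eq_integral => x _; apply/esym/cvg_lim.
apply: cvg_monotone_convergence => //.
- move=> n; apply: emeasurable_funM => //.
  apply: measurable_fun_integral_kernel => //; first by move=> e; rewrite lee_fin.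
  exact/measurable_EFinP.
- by move=> n x _; rewrite mule_ge0.
- by move=> x _ a b ab; rewrite lee_wpmul2l//; exact: ndf.
Qed.

End integral_weighted_kernel.

Section eq_integral_weighted_kernel.
Import HBNNSimple.

(** The transfer principle: linearity carries an identity on sets to simple functions, and monotone
    convergence to nonnegative ones. The weights hold the other factor of a second moment. *)
Lemma eq_integral_weighted_kernel d d' d'' (X : measurableType d)
    (Y : measurableType d') (E : measurableType d'') (R : realType)
    (mu : {measure set X -> \bar R}) (nu : {measure set Y -> \bar R})
    (V : X -> \bar R) (W : Y -> \bar R)
    (kappa : X -> {measure set E -> \bar R})
    (lambda : Y -> {measure set E -> \bar R}) (f : E -> \bar R) :
  (forall x, 0 <= V x)%E -> measurable_fun [set: X] V ->
  (forall y, 0 <= W y)%E -> measurable_fun [set: Y] W ->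
  (forall A, measurable A -> measurable_fun [set: X] (kappa ^~ A)) ->
  (forall A, measurable A -> measurable_fun [set: Y] (lambda ^~ A)) ->
  (forall A, measurable A ->
    \int[mu]_x (V x * kappa x A) = \int[nu]_y (W y * lambda y A))%E ->
  measurable_fun [set: E] f -> (forall e, 0 <= f e)%E ->
  (\int[mu]_x (V x * \int[kappa x]_e f e) =
   \int[nu]_y (W y * \int[lambda y]_e f e))%E.
Proof.
move=> V0 mV W0 mW mkappa mlambda eqA mf f0.
have eq_nnsfun (g : {nnsfun E >-> R}) :
    (\int[mu]_x (V x * \int[kappa x]_e (g e)%:E) =
     \int[nu]_y (W y * \int[lambda y]_e (g e)%:E))%E.
  rewrite !integral_weighted_kernel_nnsfun//.
  by apply: eq_fsbigr => r _; rewrite eqA.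
have := @cvg_integral_weighted_kernel _ _ _ _ _ mu V kappa V0 mV mkappa f mf f0.
under eq_fun do rewrite eq_nnsfun.
move=> h; apply: (cvg_unique _ h) => //.
exact: cvg_integral_weighted_kernel.
Qed.

End eq_integral_weighted_kernel.

(** * Moments of a Poisson process *)

Lemma poisson_probS {R : realType} (l : R) (n k : nat) : 0 <= l ->
  ((k.+1%:R)%:E * poisson_prob l n [set k.+1] =
   l%:E * poisson_prob l n [set k])%E.
Proof.
rewrite le_eqVlt => /predU1P[<-|l0]; rewrite /poisson_prob.
  (* At rate 0 the law is the Dirac mass at 0, which gives no mass to [k.+1]. *)
  by rewrite ltxx /dirac indicE memNset ?mule0 ?mul0e.
rewrite l0 !esum_set1 ?lee_fin ?poisson_pmf_ge0//.
rewrite -!EFinM /poisson_pmf l0 exprS factS natrM invfM.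
have kS : k.+1%:R != 0 :> R by rewrite pnatr_eq0.
by congr EFin; rewrite -!mulrA (mulrCA k.+1%:R) (mulrCA k.+1%:R) mulVKf.
Qed.

(** The Chen-Stein identity E[K phi(K)] = l E[phi(K + 1)] for K Poisson of rate l. Taking phi = 1
    gives the mean, phi(k) = k the second moment. *)
Lemma poisson_prob_shift {R : realType} (l : R) (n : nat)
    (phi : nat -> \bar R) : 0 <= l -> (forall k, 0 <= phi k)%E ->
  (\sum_(0 <= k <oo) (k%:R%:E * phi k * poisson_prob l n [set k]) =
   l%:E * \sum_(0 <= k <oo) (phi k.+1 * poisson_prob l n [set k]))%E.
Proof.
move=> l0 phi0; have p0 k : (0 <= poisson_prob l n [set k])%E by [].
rewrite nneseries_recl//; last by move=> k _; rewrite !mule_ge0// lee_fin.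
rewrite !mul0e add0e -nneseries_addn; last first.
  by move=> k; rewrite !mule_ge0// lee_fin.
rewrite -nneseriesZl; last by move=> k _; rewrite mule_ge0.
apply: eq_eseriesr => k _; rewrite addn1.
by rewrite muleAC poisson_probS// muleAC -muleA.
Qed.

Lemma poisson_prob_sum {R : realType} (l : R) (n : nat) :
  (\sum_(0 <= k <oo) poisson_prob l n [set k] = 1)%E.
Proof.
rewrite -(@probability_setT _ _ _ (poisson_prob l n)).
rewrite (_ : [set: nat] = \bigcup_k [set k]); last first.
  by apply/seteqP; split => // k _; exists k.
rewrite measure_bigcup//; last first.
  by move=> i j _ _ [x [/= -> ->]].
by apply: eq_eseriesl => k; rewrite in_setT.
Qed.

Section poisson_moments.
Context {d d'} {Omega : measurableType d} {E : measurableType d'}.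
Context {R : realType}.
Context {P : probability Omega R} {Lambda : {measure set E -> \bar R}}.
Context {N : R.-ker Omega ~> E}.
Hypothesis hN : poisson_point_process P Lambda N.
Local Open Scope ereal_scope.

Lemma measurable_ppp_eq (A : set E) (x : \bar R) : measurable A ->
  measurable [set o | N o A = x].
Proof.
move=> mA; rewrite -[X in measurable X]setTI.
exact: (measurable_kernel N A mA measurableT [set x] (emeasurable_set1 x)).
Qed.

Let trivIset_ppp_eq (A : set E) :
  trivIset [set: nat] (fun k => [set o | N o A = k%:R%:E]).
Proof.
by move=> i j _ _ [p [/= -> [h]]]; apply/eqP; rewrite -(eqr_nat R) h.
Qed.

Let bigcup_ppp_eq (A : set E) : measurable A ->
  \bigcup_k [set o | N o A = k%:R%:E] = ~` [set o | N o A = +oo].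
Proof.
move=> mA; apply/seteqP; split => o /=; first by move=> [k _ /= ->].
by case: (ppp_integer hN o mA) => // -[k oAk] _; exists k.
Qed.

(** The Poisson masses of the natural numbers already sum to 1. *)
Lemma ppp_pinfty (A : set E) : measurable A -> Lambda A < +oo ->
  P [set o | N o A = +oo] = 0.
Proof.
move=> mA LA; have mAy := measurable_ppp_eq A +oo mA.
rewrite -[X in P X]setCK probability_setC; last exact: measurableC.
rewrite -bigcup_ppp_eq// measure_bigcup//; last first.
  by move=> k _; exact: measurable_ppp_eq.
rewrite (eq_eseriesl (Q := xpredT)); last by move=> k; rewrite in_setT.
rewrite (eq_eseriesr (g := fun k => poisson_prob (fine (Lambda A)) 0 [set k])).
  by rewrite poisson_prob_sum subee.
by move=> k _; rewrite -(ppp_poisson hN mA LA).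
Qed.

Lemma integral_ppp_split (A : set E) (g : Omega -> \bar R) :
  measurable A -> Lambda A < +oo ->
  measurable_fun [set: Omega] g -> (forall o, 0 <= g o) ->
  \int[P]_o g o =
  \sum_(0 <= k <oo) \int[P]_(o in [set o | N o A = k%:R%:E]) g o.
Proof.
move=> mA LA mg g0; have mAy := measurable_ppp_eq A +oo mA.
rewrite (ge0_negligible_integral mAy)//; last exact: ppp_pinfty.
rewrite setTD -bigcup_ppp_eq// ge0_integral_bigcup//.
- by move=> k; exact: measurable_ppp_eq.
- exact: measurable_funTS.
Qed.

Lemma integral_ppp_discrete (A : set E) (phi : \bar R -> \bar R) :
  measurable A -> Lambda A < +oo ->
  measurable_fun [set: \bar R] phi -> (forall x, 0 <= x -> 0 <= phi x) ->
  \int[P]_o phi (N o A) = \sum_(0 <= k <oo)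
    (phi k%:R%:E * poisson_prob (fine (Lambda A)) 0 [set k]).
Proof.
move=> mA LA mphi phi0; rewrite (integral_ppp_split A)//; last 2 first.
- by apply: measurableT_comp => //; exact: measurable_kernel.
- by move=> o; exact: phi0.
apply: eq_eseriesr => k _; rewrite -(ppp_poisson hN mA)//.
rewrite -integral_cst; last exact: measurable_ppp_eq.
by apply: eq_integral => o; rewrite inE/= => ->.
Qed.

Lemma ppp_mean_finite (A : set E) : measurable A -> Lambda A < +oo ->
  \int[P]_o N o A = Lambda A.
Proof.
move=> mA LA; rewrite (integral_ppp_discrete A idfun)//;
  last exact: measurable_id.
have := @poisson_prob_shift R (fine (Lambda A)) 0 (cst 1).
rewrite fine_ge0// => /(_ isT).
under eq_eseriesr do rewrite mule1.
move=> ->//; under eq_eseriesr do rewrite mul1e.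
by rewrite poisson_prob_sum mule1 fineK// ge0_fin_numE.
Qed.

(** The count of [A] is almost surely +oo. The factor [g] is left free so that another count can
    take its place. *)
Lemma ppp_pinfty_mean (A : set E) (g : Omega -> \bar R) :
  measurable A -> Lambda A = +oo ->
  measurable_fun [set: Omega] g -> (forall o, 0 <= g o) ->
  \int[P]_o (N o A * g o) = +oo * \int[P]_o g o.
Proof.
move=> mA LA mg g0; have mAy := measurable_ppp_eq A +oo mA.
rewrite -ge0_integralZl//.
apply: ge0_ae_eq_integral => //.
- by apply: emeasurable_funM => //; exact: measurable_kernel.
- exact: measurable_funeM.
- by move=> o _; rewrite mule_ge0.
- by move=> o _; rewrite mule_ge0.
exists (~` [set o | N o A = +oo]); split.
- exact: measurableC.
- by have := probability_setC P mAy; rewrite (ppp_infinite hN mA LA) subee.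
- by move=> o /= h oA; apply: h => _; rewrite oA.
Qed.

Lemma ppp_mean (A : set E) : measurable A -> \int[P]_o N o A = Lambda A.
Proof.
move=> mA; have [LA|] := ltP (Lambda A) +oo; first exact: ppp_mean_finite.
rewrite leye_eq => /eqP LA; under eq_integral do rewrite -[N _ A]mule1.
rewrite (ppp_pinfty_mean A (cst 1))// integral_cst//.
by rewrite [X in 1 * X]probability_setT !mule1 LA.
Qed.

Lemma ppp_mean_sqr (A : set E) : measurable A -> Lambda A < +oo ->
  \int[P]_o (N o A * N o A) = Lambda A * Lambda A + Lambda A.
Proof.
move=> mA LA; rewrite (integral_ppp_discrete A (fun x => x * x))//; last 2 first.
- exact: emeasurable_funM.
- by move=> x x0; rewrite mule_ge0.
have LAfin : (fine (Lambda A))%:E = Lambda A by rewrite fineK// ge0_fin_numE.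
rewrite (@poisson_prob_shift R _ 0 (fun k => k%:R%:E)); last 2 first.
- by rewrite fine_ge0.
- by move=> k; rewrite lee_fin.
under eq_eseriesr do rewrite -natr1 EFinD ge0_muleDl ?lee_fin// mul1e.
rewrite nneseriesD; last 2 first.
- by move=> k _ _; rewrite mule_ge0// lee_fin.
- by [].
rewrite poisson_prob_sum -(integral_ppp_discrete A idfun)//;
  last exact: measurable_id.
rewrite ppp_mean//.
by rewrite LAfin ge0_muleDr// mule1.
Qed.

Lemma ppp_pair (A B : set E) (j k : nat) : measurable A -> measurable B ->
  [disjoint A & B] ->
  P ([set o | N o A = j%:R%:E] `&` [set o | N o B = k%:R%:E]) =
  P [set o | N o A = j%:R%:E] * P [set o | N o B = k%:R%:E].
Proof.
move=> mA mB AB.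
have := @ppp_independent _ _ _ _ _ _ _ _ hN 2
  (fun i : 'I_2 => if i == ord0 then A else B)
  (fun i : 'I_2 => if i == ord0 then [set j%:R%:E] else [set k%:R%:E]).
rewrite big_ord_recl big_ord1/= => <-.
- congr (P _); apply/seteqP; split => o /=.
    by move=> [oA oB] i _ /=; case: ifPn.
  by move=> oAB; split; [have := oAB ord0|have := oAB (lift ord0 ord0)]; apply.
- by move=> i; case: ifPn.
- move=> i l _ _ [e []]; case: ifPn => i0; case: ifPn => l0 //=.
  + by move=> _ _; rewrite (eqP i0) (eqP l0).
  + by move=> Ae Be; move/disj_setPS : AB => /(_ e)[].
  + by move=> Be Ae; move/disj_setPS : AB => /(_ e)[].
  + move=> _ _; apply/val_inj => /=; move: (ltn_ord i) (ltn_ord l) i0 l0.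
    rewrite -!val_eqE/=.
    by case: (nat_of_ord i) => [|[|]]//; case: (nat_of_ord l) => [|[|]].
- by move=> i; case: ifPn => _; exact: emeasurable_set1.
Qed.

(** Both counts are expanded over their values, natural numbers up to a null set, and [ppp_pair]
    factors each term of the double sum. *)
Lemma ppp_mean_disjoint (A B : set E) : measurable A -> measurable B ->
  [disjoint A & B] -> Lambda A < +oo -> Lambda B < +oo ->
  \int[P]_o (N o A * N o B) = Lambda A * Lambda B.
Proof.
move=> mA mB AB LA LB.
have mN C : measurable C -> measurable_fun setT (fun o => N o C).
  by move=> mC; exact: measurable_kernel.
have restricted j : \int[P]_(o in [set o | N o A = j%:R%:E]) N o B =
    P [set o | N o A = j%:R%:E] * Lambda B.
  have mAj := measurable_ppp_eq A j%:R%:E mA.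
  rewrite integral_mkcond (integral_ppp_split B)//; last 2 first.
  - by apply/(measurable_restrictT _ mAj)/measurable_funTS/mN.
  - by apply: erestrict_ge0.
  rewrite -[in RHS](ppp_mean B)// (integral_ppp_discrete B idfun)//;
    last exact: measurable_id.
  have /fineK <- : P [set o | N o A = j%:R%:E] \is a fin_num.
    exact: fin_num_measure.
  rewrite -nneseriesZl; last by move=> k _; rewrite mule_ge0// lee_fin.
  apply: eq_eseriesr => k _; rewrite fineK; last exact: fin_num_measure.
  rewrite muleCA -(ppp_poisson hN mB)// -ppp_pair//.
  rewrite -integral_mkcondr setIC.
  rewrite -integral_cst; last by apply: measurableI; exact: measurable_ppp_eq.
  by apply: eq_integral => o; rewrite inE/= => -[_ ->].
rewrite (integral_ppp_split A)//; last by apply: emeasurable_funM; exact: mN.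
rewrite -{1}(ppp_mean A)// (integral_ppp_discrete A idfun)//;
  last exact: measurable_id.
have /fineK <- : Lambda B \is a fin_num by rewrite ge0_fin_numE.
rewrite muleC -nneseriesZl; last by move=> k _; rewrite mule_ge0// lee_fin.
apply: eq_eseriesr => j _; rewrite fineK ?ge0_fin_numE//.
rewrite muleC -muleA -(ppp_poisson hN mA)// -restricted.
rewrite /= -ge0_integralZl//; last 2 first.
- exact: measurable_ppp_eq.
- exact/measurable_funTS/mN.
by apply: eq_integral => o; rewrite inE/= => ->.
Qed.

(** In the finite case, cutting into A & B, A \ B and B \ A leaves one square and three products of
    disjoint counts; the extra term comes from the square. *)
Lemma ppp_second_moment (A B : set E) : measurable A -> measurable B ->
  \int[P]_o (N o A * N o B) = Lambda (A `&` B) + Lambda A * Lambda B.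
Proof.
have infinite_case (C D : set E) : measurable C -> measurable D ->
    Lambda C = +oo ->
    \int[P]_o (N o C * N o D) = Lambda (C `&` D) + Lambda C * Lambda D.
  move=> mC mD LC; rewrite ppp_pinfty_mean//; last exact: measurable_kernel.
  rewrite ppp_mean// LC.
  (* If [Lambda D] is 0, both sides are 0 because +oo * 0 = 0; otherwise both are +oo. *)
  have [LD|LD] := eqVneq (Lambda D) 0.
    rewrite (_ : Lambda (C `&` D) = 0) ?LD ?mule0 ?adde0//.
    apply/eqP; rewrite eq_le measure_ge0 andbT -LD.
    by apply: le_measure; rewrite ?inE//; exact: measurableI.
  by rewrite gt0_mulye ?lt0e ?LD//= addey// gt_eqF// (lt_le_trans _ (measure_ge0 _ _)).
move=> mA mB.
have [LA|] := ltP (Lambda A) +oo; last first.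
  by rewrite leye_eq => /eqP LA; exact: infinite_case.
have [LB|] := ltP (Lambda B) +oo; last first.
  rewrite leye_eq => /eqP LB; under eq_integral do rewrite muleC.
  by rewrite setIC [in RHS]muleC; exact: infinite_case.
have mC : measurable (A `&` B) by exact: measurableI.
have mA' : measurable (A `\` B) by exact: measurableD.
have mB' : measurable (B `\` A) by exact: measurableD.
have LleA X : measurable X -> X `<=` A -> Lambda X < +oo.
  by move=> mX XA; apply: le_lt_trans LA; apply: le_measure; rewrite ?inE.
have LleB X : measurable X -> X `<=` B -> Lambda X < +oo.
  by move=> mX XB; apply: le_lt_trans LB; apply: le_measure; rewrite ?inE.
have LC : Lambda (A `&` B) < +oo by apply: LleA.
have LA' : Lambda (A `\` B) < +oo by apply: LleA.
have LB' : Lambda (B `\` A) < +oo by apply: LleB.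
have splitA (nu : {measure set E -> \bar R}) :
    nu A = nu (A `&` B) + nu (A `\` B).
  by rewrite (measureDI nu mA mB) addeC.
have splitB (nu : {measure set E -> \bar R}) :
    nu B = nu (A `&` B) + nu (B `\` A).
  by rewrite (measureDI nu mB mA) addeC setIC.
have mN X : measurable X -> measurable_fun setT (fun o => N o X).
  by move=> mX; exact: measurable_kernel.
under eq_integral do rewrite splitA (splitB (N _)) ge0_muleDl// !ge0_muleDr//.
have mNN X Y : measurable X -> measurable Y ->
    measurable_fun setT (fun o => N o X * N o Y).
  by move=> mX mY; apply: emeasurable_funM; exact: mN.
rewrite !ge0_integralD//; do ?[exact: mNN]; do ?[by move=> o _; rewrite adde_ge0];
  do ?[by apply: emeasurable_funD; exact: mNN].
have disj (X Y : set E) : X `&` Y `<=` set0 -> [disjoint X & Y].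
  by move=> XY; exact/disj_setPS.
rewrite ppp_mean_sqr// !ppp_mean_disjoint//; last 3 first.
- by apply: disj => e [[? ?] []].
- by apply: disj => e [[? ?] []].
- by apply: disj => e [[? ?] []].
rewrite (splitA Lambda) (splitB Lambda) ge0_muleDl// !ge0_muleDr//.
by rewrite (addeC (_ * _) (Lambda (A `&` B))) !addeA.
Qed.

End poisson_moments.

(** * Campbell's formulas for the first two moments *)

Section campbell.
Context {d d'} {Omega : measurableType d} {E : measurableType d'}.
Context {R : realType}.
Context {P : probability Omega R} {Lambda : {measure set E -> \bar R}}.
Context {N : R.-ker Omega ~> E}.
Hypothesis hN : poisson_point_process P Lambda N.
Local Open Scope ereal_scope.

Let mdirac (A : set E) : measurable A ->
  measurable_fun [set: E] (fun e => \d_e A : \bar R).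
Proof. exact: measurable_fun_dirac. Qed.

Let mN (A : set E) : measurable A -> measurable_fun [set: Omega] (N ^~ A).
Proof. exact: measurable_kernel. Qed.

Let mulr_dirac (A : set E) (f : E -> \bar R) : measurable A ->
  measurable_fun [set: E] f -> (forall e, 0 <= f e) ->
  \int[Lambda]_e (f e * \d_e A) = \int[Lambda]_(e in A) f e.
Proof.
move=> mA mf f0; rewrite [RHS]integral_mkcond.
apply: eq_integral => e _; rewrite patchE diracE.
by case: (e \in A); rewrite ?mule1 ?mule0.
Qed.

Lemma measurable_integral_ppp (f : E -> \bar R) :
  measurable_fun [set: E] f -> (forall e, 0 <= f e) ->
  measurable_fun [set: Omega] (fun o => \int[N o]_e f e).
Proof. by move=> mf f0; exact: measurable_fun_integral_kernel. Qed.

(* Integrating against [N o] is compared with integrating against the kernel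
   of Dirac masses, which evaluates [f]. *)
Lemma campbell_mean (f : E -> \bar R) :
  measurable_fun [set: E] f -> (forall e, 0 <= f e) ->
  \int[P]_o (\int[N o]_e f e) = \int[Lambda]_e f e.
Proof.
move=> mf f0.
transitivity (\int[P]_o (1 * \int[N o]_e f e)).
  by apply: eq_integral => o _; rewrite mul1e.
rewrite (@eq_integral_weighted_kernel _ _ _ _ _ _ _ P Lambda (cst 1) (cst 1)
  N (fun e => \d_e))//.
  by apply: eq_integral => e _; rewrite mul1e integral_dirac// diracT mul1e.
move=> A mA; rewrite mulr_dirac// integral_cst// mul1e -(ppp_mean hN A)//.
by apply: eq_integral => o _; rewrite mul1e.
Qed.

Let campbell_mean_setM (B : set E) (f : E -> \bar R) : measurable B ->
  measurable_fun [set: E] f -> (forall e, 0 <= f e) ->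
  \int[P]_o (N o B * \int[N o]_e f e) =
  \int[Lambda]_(e in B) f e + Lambda B * \int[Lambda]_e f e.
Proof.
move=> mB mf f0.
rewrite (@eq_integral_weighted_kernel _ _ _ _ _ _ _ P Lambda (N ^~ B)
  (fun e => \d_e B + Lambda B) N (fun e => \d_e))//.
- under eq_integral do rewrite integral_dirac// diracT mul1e ge0_muleDl//.
  rewrite ge0_integralD//; last 4 first.
  + by move=> e _; rewrite mule_ge0.
  + by apply: emeasurable_funM => //; exact: mdirac.
  + by move=> e _; rewrite mule_ge0.
  + exact: measurable_funeM.
  rewrite ge0_integralZl//; congr (_ + _).
  by under eq_integral do rewrite muleC; rewrite mulr_dirac.
- exact: mN.
- by move=> e; rewrite adde_ge0.
- by apply: emeasurable_funD => //; exact: mdirac.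
- move=> A mA; rewrite (ppp_second_moment hN)//.
  rewrite mulr_dirac//; last 2 first.
  + by apply: emeasurable_funD => //; exact: mdirac.
  + by move=> e; rewrite adde_ge0.
  rewrite ge0_integralD//; last exact/measurable_funTS/mdirac.
  rewrite integral_cst//; congr (_ + _).
  rewrite integral_mkcond.
  transitivity (\int[Lambda]_e (\1_(A `&` B) e)%:E).
    by rewrite integral_indic// ?setIT 1?setIC//; exact: measurableI.
  apply: eq_integral => e _; rewrite patchE diracE indicE in_setI.
  by case: (e \in A); rewrite ?mul1e.
Qed.

Lemma campbell_second_moment (f g : E -> \bar R) :
  measurable_fun [set: E] f -> (forall e, 0 <= f e) ->
  measurable_fun [set: E] g -> (forall e, 0 <= g e) ->
  \int[P]_o (\int[N o]_e f e * \int[N o]_e g e) =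
  \int[Lambda]_e (f e * g e) +
  \int[Lambda]_e f e * \int[Lambda]_e g e.
Proof.
move=> mf f0 mg g0.
have I0 : 0 <= \int[Lambda]_e f e by exact: integral_ge0.
rewrite (@eq_integral_weighted_kernel _ _ _ _ _ _ _ P Lambda
  (fun o => \int[N o]_e f e) (fun e => f e + \int[Lambda]_e f e)
  N (fun e => \d_e))//.
- under eq_integral do rewrite integral_dirac// diracT mul1e ge0_muleDl//.
  rewrite ge0_integralD//; last 4 first.
  + by move=> e _; rewrite mule_ge0.
  + exact: emeasurable_funM.
  + by move=> e _; rewrite mule_ge0.
  + exact: measurable_funeM.
  by rewrite ge0_integralZl.
- by move=> o; exact: integral_ge0.
- exact: measurable_integral_ppp.
- by move=> e; rewrite adde_ge0.
- exact: emeasurable_funD.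
- move=> A mA; under eq_integral do rewrite muleC.
  rewrite campbell_mean_setM// mulr_dirac//; last 2 first.
  + exact: emeasurable_funD.
  + by move=> e; rewrite adde_ge0.
  rewrite ge0_integralD//; last exact: measurable_funTS.
  by rewrite integral_cst// muleC.
Qed.

End campbell.

(** * Uniqueness in law of a Poisson process *)

(** The pushforward, bundled with its measure structure. *)
Definition image_measure {d d'} {T1 : measurableType d} {T2 : measurableType d'}
    {R : realType} (m : {measure set T1 -> \bar R}) (f : T1 -> T2)
    (mf : measurable_fun [set: T1] f) : {measure set T2 -> \bar R} :=
  measure_function_pushforward__canonical__measure_function_Measure m mf.

Lemma image_measureE {d d'} {T1 : measurableType d} {T2 : measurableType d'}
    {R : realType} (m : {measure set T1 -> \bar R}) (f : T1 -> T2)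
    (mf : measurable_fun [set: T1] f) (A : set T2) :
  image_measure m f mf A = m (f @^-1` A).
Proof. by []. Qed.

Lemma ge0_integral_image_measure {d d'} {T1 : measurableType d}
    {T2 : measurableType d'} {R : realType} (m : {measure set T1 -> \bar R})
    (f : T1 -> T2) (mf : measurable_fun [set: T1] f) (k : T2 -> \bar R) :
  measurable_fun [set: T2] k -> (forall y, 0 <= k y)%E ->
  (\int[image_measure m f mf]_y k y = \int[m]_x k (f x))%E.
Proof.
move=> mk k0.
exact: (ge0_integral_pushforward mf m measurableT mk (fun y _ => k0 y)).
Qed.

(** * Measures on tuples are determined by boxes *)

Section box.
Context {d} {T : measurableType d} {n : nat}.

Definition box (B : 'I_n -> set T) : set (n.-tuple T) :=
  [set y | forall i, B i (tnth y i)].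

Lemma measurable_box (B : 'I_n -> set T) :
  (forall i, measurable (B i)) -> measurable (box B).
Proof.
move=> mB; rewrite (_ : box B = \bigcap_i ((@tnth _ T)^~ i @^-1` B i)); last first.
  by apply/seteqP; split => y h i //=; exact: h.
apply: fin_bigcap_measurable => // i _.
by rewrite -[X in measurable X]setTI; exact: measurable_tnth.
Qed.

Lemma setI_closed_box :
  setI_closed [set C | exists2 B, (forall i, measurable (B i)) & C = box B].
Proof.
move=> _ _ [B mB ->] [C mC ->]; exists (fun i => B i `&` C i).
  by move=> i; exact: measurableI.
by apply/seteqP; split => [y [yB yC] i|y yBC]; [|split => i; case: (yBC i)].
Qed.

Lemma measurable_tuple_box :
  @measurable _ (n.-tuple T) =
  <<s [set C | exists2 B, (forall i, measurable (B i)) & C = box B] >>.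
Proof.
apply/seteqP; split.
  apply: smallest_sub; first exact: smallest_sigma_algebra.
  move=> A; rewrite -bigcup_seq => -[i _ [B mB <-]].
  apply: sub_sigma_algebra.
  (* A constraint on one coordinate is a box whose other sides are full. *)
  exists (fun j => if j == i then B else setT).
    by move=> j; case: ifP.
  apply/seteqP; split => [y [_ yB] j|y /(_ i)]; last by rewrite eqxx.
  by case: eqP => // ->.
apply: smallest_sub; first exact: sigma_algebra_measurable.
by move=> _ [B mB ->]; exact: measurable_box.
Qed.

Lemma tuple_measure_unique {R : realType}
    (m1 m2 : {measure set (n.-tuple T) -> \bar R}) :
  (m1 setT < +oo)%E ->
  (forall B, (forall i, measurable (B i)) -> m1 (box B) = m2 (box B)) ->
  forall C, measurable C -> m1 C = m2 C.
Proof.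
move=> m1T m12 C mC; apply: (measure_unique
  [set C | exists2 B, (forall i, measurable (B i)) & C = box B]
  (fun _ => setT)) => //.
- exact: measurable_tuple_box.
- exact: setI_closed_box.
- move=> _; exists (fun _ => setT) => //.
  by apply/seteqP; split.
- by rewrite bigcup_const//; exists 0%N.
- by move=> _ [B mB ->]; exact: m12.
Qed.

End box.

(** * The space of measures and its sigma-algebra of evaluations *)

Section cylinder.
Context {d} (E : measurableType d) (R : realType).

(** A separate name for the type of measures, to which the structures required of the carrier of a
    sigma-algebra are attached. *)
Definition measure_on : Type := {measure set E -> \bar R}.

HB.instance Definition _ := gen_eqMixin measure_on.
HB.instance Definition _ := gen_choiceMixin measure_on.
HB.instance Definition _ := isPointed.Build measure_on mzero.

(** An arbitrary finite index type makes this a pi-system at once: an intersection is indexed by the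
    sum of the two index types. *)
Definition cylinder : set (set measure_on) :=
  [set C | exists (I : finType) (A : I -> set E) (B : I -> set (\bar R)),
    [/\ forall i, measurable (A i), forall i, measurable (B i) &
        C = [set nu : measure_on | forall i, B i (nu (A i))]]].

Lemma setI_closed_cylinder : setI_closed cylinder.
Proof.
move=> _ _ [I [A [B [mA mB ->]]]] [J [A' [B' [mA' mB' ->]]]].
exists (I + J)%type.
exists (fun k => match k with inl i => A i | inr j => A' j end).
exists (fun k => match k with inl i => B i | inr j => B' j end).
split=> [[i|j]|[i|j]|] //.
apply/seteqP; split => [nu [nuA nuA'] [i|j]|nu h] //=.
by split => [i|j]; [exact: (h (inl i))|exact: (h (inr j))].
Qed.

Definition measure_spaceType := g_sigma_algebraType cylinder.

Lemma measurable_evaluation (A : set E) : measurable A ->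
  measurable_fun [set: measure_spaceType]
    (fun nu : measure_spaceType => (nu : measure_on) A).
Proof.
move=> mA _ B mB; rewrite setTI; apply: sub_sigma_algebra.
exists unit, (fun=> A), (fun=> B); split => //.
by apply/seteqP; split => [nu h []|nu /(_ tt)].
Qed.

End cylinder.

Section atoms.
Context {d} {E : measurableType d} {I : finType} (A : I -> set E).

Definition pattern (e : E) : {set I} := [set i | `[< A i e >]].

(** The atoms, some possibly empty, of the finite algebra generated by the [A i]. They are numbered
    by ordinals because independence is stated for families over ['I_n]. *)
Definition atom (j : 'I_#|{set I}|) : set E :=
  [set e | pattern e = enum_val j].

Lemma trivIset_atom : trivIset [set: 'I_#|{set I}|] atom.
Proof. by move=> j k _ _ [e []]; rewrite /atom/= => -> /enum_val_inj. Qed.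

Lemma measurable_atom (j : 'I_#|{set I}|) :
  (forall i, measurable (A i)) -> measurable (atom j).
Proof.
move=> mA; rewrite (_ : atom j =
    \bigcap_i (if i \in enum_val j then A i else ~` A i)); last first.
  apply/seteqP; split => [e /= <- i _|e h /=].
    by rewrite inE; case: ifPn => [/asboolP//|/asboolP].
  apply/setP => i; rewrite inE; have := h i Logic.I.
  by case: ifPn => _ /= => [/asboolP//|?]; apply/asboolP.
apply: fin_bigcap_measurable => // i _.
by case: ifPn => // _; exact: measurableC.
Qed.

Lemma measure_atoms {R : realType} (nu : {measure set E -> \bar R}) (i : I) :
  (forall i, measurable (A i)) ->
  nu (A i) = (\sum_(j < #|{set I}| | i \in enum_val j) nu (atom j))%E.
Proof.
move=> mA; rewrite -measure_bigsetU_ord//; last 2 first.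
- by move=> j; exact: measurable_atom.
- exact: trivIset_atom.
congr (nu _); rewrite -bigcup_seq_cond.
apply/seteqP; split => [e Aie|e [j /=/andP[_ ij] /= ej]].
  exists (enum_rank (pattern e)) => /=; last by rewrite /atom/= enum_rankK.
  by rewrite mem_index_enum enum_rankK inE; apply/asboolP.
by move: ij; rewrite -ej inE => /asboolP.
Qed.

End atoms.

Section ppp_unique.
Context {d d' d'' : measure_display}.
Context {Omega : measurableType d} {Omega' : measurableType d'}.
Context {E : measurableType d''} {R : realType}.
Context {P : probability Omega R} {P' : probability Omega' R}.
Context {Lambda : {measure set E -> \bar R}}.
Context {N : R.-ker Omega ~> E} {N' : R.-ker Omega' ~> E}.
Hypothesis hN : poisson_point_process P Lambda N.
Hypothesis hN' : poisson_point_process P' Lambda N'.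
Local Open Scope ereal_scope.

Lemma ppp_law_infinite {d0} {Omega0 : measurableType d0}
    {P0 : probability Omega0 R} {N0 : R.-ker Omega0 ~> E}
    (hN0 : poisson_point_process P0 Lambda N0) (A : set E) (B : set (\bar R)) :
  measurable A -> Lambda A = +oo -> measurable B ->
  P0 [set o | B (N0 o A)] = if +oo \in B then 1 else 0.
Proof.
move=> mA LA mB.
have mAB : measurable [set o | B (N0 o A)].
  by rewrite -[X in measurable X]setTI; exact: measurable_kernel.
have mAy : measurable [set o | N0 o A = +oo] by exact: measurable_ppp_eq.
have PA := ppp_infinite hN0 mA LA.
case: ifPn => [/set_mem|/negP] yB.
  apply/eqP; rewrite eq_le probability_le1//= -PA.
  by apply: le_measure; rewrite ?inE// => o /= ->.
apply/eqP; rewrite eq_le measure_ge0 andbT.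
rewrite -(subee (x := 1))// -{2}PA -probability_setC//.
apply: le_measure; rewrite ?inE//; first exact: measurableC.
by move=> o /= oB oy; apply: yB; rewrite inE -oy.
Qed.

Lemma ppp_law_finite {d0} {Omega0 : measurableType d0}
    {P0 : probability Omega0 R} {N0 : R.-ker Omega0 ~> E}
    (hN0 : poisson_point_process P0 Lambda N0) (A : set E) (B : set (\bar R)) :
  measurable A -> Lambda A < +oo -> measurable B ->
  P0 [set o | B (N0 o A)] = \sum_(0 <= k <oo)
    ((\1_B (k%:R%:E : \bar R))%:E *
      poisson_prob (fine (Lambda A)) 0 [set k]).
Proof.
move=> mA LA mB.
have mAB : measurable [set o | B (N0 o A)].
  by rewrite -[X in measurable X]setTI; exact: measurable_kernel.
rewrite -(integral_ppp_discrete hN0 A (fun x => (\1_B x)%:E))//.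
  by rewrite -[X in P0 X]setTI setIC -integral_indic.
exact/measurable_EFinP/measurable_indic.
Qed.

Lemma ppp_law (A : set E) (B : set (\bar R)) : measurable A -> measurable B ->
  P [set o | B (N o A)] = P' [set o | B (N' o A)].
Proof.
move=> mA mB; have [LA|] := ltP (Lambda A) +oo.
  by rewrite (ppp_law_finite hN)// (ppp_law_finite hN').
rewrite leye_eq => /eqP LA.
by rewrite (ppp_law_infinite hN)// (ppp_law_infinite hN').
Qed.

Let counts {d0} {Omega0 : measurableType d0} (N0 : R.-ker Omega0 ~> E)
    (n : nat) (A : 'I_n -> set E) (o : Omega0) : n.-tuple (\bar R) :=
  [tuple N0 o (A i) | i < n].

Let measurable_counts {d0} {Omega0 : measurableType d0}
    (N0 : R.-ker Omega0 ~> E) (n : nat) (A : 'I_n -> set E) :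
  (forall i, measurable (A i)) ->
  measurable_fun [set: Omega0] (counts N0 n A).
Proof.
move=> mA; apply/measurable_fun_tnthP => i.
rewrite (_ : _ \o _ = N0 ^~ (A i)); first exact: measurable_kernel.
by apply/funext => o /=; rewrite tnth_mktuple.
Qed.

(** By independence both laws give a box the product of its marginal probabilities, which [ppp_law]
    identifies; boxes determine a finite measure. *)
Lemma ppp_joint_law_disjoint (n : nat) (A : 'I_n -> set E)
    (C : set (n.-tuple (\bar R))) :
  (forall i, measurable (A i)) -> trivIset [set: 'I_n] A -> measurable C ->
  P [set o | C [tuple N o (A i) | i < n]] =
  P' [set o | C [tuple N' o (A i) | i < n]].
Proof.
move=> mA tA mC.
have mN := measurable_counts N n A mA; have mN' := measurable_counts N' n A mA.
apply: (tuple_measure_unique (image_measure P _ mN) (image_measure P' _ mN')) => //.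
  by rewrite image_measureE preimage_setT [X in X < _]probability_setT ltry.
move=> B mB; rewrite !image_measureE.
have box_event (d0 : measure_display) (Omega0 : measurableType d0)
    (N0 : R.-ker Omega0 ~> E) :
    counts N0 n A @^-1` box B =
    \bigcap_(i in [set: 'I_n]) [set o | B i (N0 o (A i))].
  apply/seteqP; split => o /= h i; have := h i; rewrite /counts tnth_mktuple//.
  exact.
rewrite !box_event; apply: etrans (ppp_independent hN mA tA mB) _.
apply: etrans (esym (ppp_independent hN' mA tA mB)).
by apply: eq_bigr => i _; exact: ppp_law.
Qed.

(** Each count is a sum of counts of disjoint atoms, so the event is the preimage of a measurable
    set [C] under the tuple of atom counts. *)
Lemma ppp_joint_law (I : finType) (A : I -> set E) (B : I -> set (\bar R)) :
  (forall i, measurable (A i)) -> (forall i, measurable (B i)) ->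
  P [set o | forall i, B i (N o (A i))] =
  P' [set o | forall i, B i (N' o (A i))].
Proof.
move=> mA mB; pose K := #|{set I}|.
pose C : set (K.-tuple (\bar R)) :=
  \bigcap_i ((fun y => \sum_(j < K | i \in enum_val j) tnth y j) @^-1` B i).
have mC : measurable C.
  apply: fin_bigcap_measurable => // i _; rewrite -[X in measurable X]setTI.
  suff : measurable_fun [set: K.-tuple (\bar R)]
    (fun y => \sum_(j < K | i \in enum_val j) tnth y j) by exact.
  rewrite (_ : (fun y => _) = fun y : K.-tuple (\bar R) =>
      \sum_(j < K) if i \in enum_val j then tnth y j else 0); last first.
    by apply/funext => y; rewrite big_mkcond.
  apply: emeasurable_sum => j.
  by case: (i \in enum_val j) => //; exact: measurable_tnth.
have atoms_event (d0 : measure_display) (Omega0 : measurableType d0)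
    (N0 : R.-ker Omega0 ~> E) :
    [set o | forall i, B i (N0 o (A i))] =
    [set o | C [tuple N0 o (atom A j) | j < K]].
  have sumE o i : \sum_(j < K | i \in enum_val j)
      tnth [tuple N0 o (atom A j) | j < K] j = N0 o (A i).
    rewrite (measure_atoms A)//; apply: eq_bigr => j _.
    by rewrite tnth_mktuple.
  apply/seteqP; split => o /= h i; last by rewrite -sumE; exact: h.
  by move=> _ /=; rewrite sumE.
rewrite !atoms_event; apply: ppp_joint_law_disjoint => //.
- by move=> j; exact: measurable_atom.
- exact: trivIset_atom.
Qed.

Let measurable_ppp_map {d0} {Omega0 : measurableType d0}
    (N0 : R.-ker Omega0 ~> E) :
  measurable_fun [set: Omega0] (fun o => N0 o : measure_spaceType E R).
Proof.
apply: (@measurability _ _ Omega0 (measure_spaceType E R) setT _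
  (cylinder E R)) => //.
move=> _ [_ [I [A [B [mA mB ->]]]] <-]; rewrite setTI.
rewrite (_ : _ @^-1` _ = \bigcap_i [set o | B i (N0 o (A i))]); last first.
  by apply/seteqP; split => [x h i _|x h i]; exact: h.
apply: fin_bigcap_measurable => // i _.
by rewrite -[X in measurable X]setTI; exact: measurable_kernel.
Qed.

Lemma ppp_unique (C : set (measure_spaceType E R)) : measurable C ->
  P [set o | C (N o)] = P' [set o | C (N' o)].
Proof.
move=> mC; have mN := measurable_ppp_map N; have mN' := measurable_ppp_map N'.
suff : image_measure P _ mN C = image_measure P' _ mN' C by [].
apply: (@measure_unique _ R (measure_spaceType E R) (cylinder E R)
  (fun _ => setT)) => //.
- exact: setI_closed_cylinder.
- move=> _; exists void, (fun=> setT), (fun=> setT); split => //.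
  by apply/seteqP; split.
- by rewrite bigcup_const//; exists 0%N.
- by move=> _ [I [A [B [mA mB ->]]]]; exact: ppp_joint_law.
- move=> _; rewrite image_measureE preimage_setT.
  by rewrite [X in X < _]probability_setT ltry.
Qed.

Lemma ppp_integrals_law (n : nat) (f : 'I_n -> E -> \bar R)
    (C : set (n.-tuple (\bar R))) :
  (forall i, measurable_fun [set: E] (f i)) -> (forall i e, 0 <= f i e) ->
  measurable C ->
  P [set o | C [tuple \int[N o]_e f i e | i < n]] =
  P' [set o | C [tuple \int[N' o]_e f i e | i < n]].
Proof.
move=> mf f0 mC.
pose integrals (nu : measure_spaceType E R) : n.-tuple (\bar R) :=
  [tuple \int[(nu : measure_on E R)]_e f i e | i < n].
have mintegrals : measurable_fun setT integrals.
  apply/measurable_fun_tnthP => i.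
  rewrite (_ : _ \o _ =
      fun nu : measure_spaceType E R => \int[(nu : measure_on E R)]_e f i e).
    (* For the evaluation sigma-algebra the identity on measures is itself a measurable kernel, so
       integration against it is measurable in the measure. *)
    apply: measurable_fun_integral_kernel => //.
    by move=> A mA; exact: measurable_evaluation.
  by apply/funext => nu /=; rewrite tnth_mktuple.
apply: (ppp_unique (integrals @^-1` C)).
by rewrite -[X in measurable X]setTI; exact: mintegrals.
Qed.

End ppp_unique.

(** * Images of a Poisson process and invariance of its intensity *)

Section image_kernel.
Context {d d' d'' : measure_display}.
Context {Omega : measurableType d} {E : measurableType d'}.
Context {E' : measurableType d''} {R : realType}.
Variables (N : R.-ker Omega ~> E) (tau : E -> E').
Hypothesis mtau : measurable_fun [set: E] tau.

Definition image_kernel (o : Omega) : {measure set E' -> \bar R} :=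
  image_measure (N o) tau mtau.

Let measurable_image_kernel (A : set E') : measurable A ->
  measurable_fun [set: Omega] (image_kernel ^~ A).
Proof.
move=> mA; apply: (measurable_kernel N (tau @^-1` A)).
by rewrite -[X in measurable X]setTI; exact: mtau.
Qed.

HB.instance Definition _ :=
  isKernel.Build _ _ _ _ _ image_kernel measurable_image_kernel.

(** The mapping theorem: preimages under [tau] keep measurability and disjointness, and turn one
    intensity into the other. *)
Lemma ppp_image (P : probability Omega R) (Lambda : {measure set E -> \bar R})
    (Lambda' : {measure set E' -> \bar R}) :
  (forall A, measurable A -> Lambda (tau @^-1` A) = Lambda' A) ->
  poisson_point_process P Lambda N ->
  poisson_point_process P Lambda' image_kernel.
Proof.
move=> LL' hN.
have mpre A : measurable A -> measurable (tau @^-1` A).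
  by move=> mA; rewrite -[X in measurable X]setTI; exact: mtau.
split.
- by move=> o A mA; exact: (ppp_integer hN o (mpre A mA)).
- move=> A mA; rewrite -LL'// => LA k.
  exact: (ppp_poisson hN (mpre A mA) LA k).
- by move=> A mA; rewrite -LL'//; exact: (ppp_infinite hN (mpre A mA)).
- move=> n A B mA tA mB.
  apply: (@ppp_independent _ _ _ _ _ _ _ _ hN n (fun i => tau @^-1` A i)) => //.
    by move=> i; exact: mpre.
  by move=> i j _ _ [e [ei ej]]; apply: tA => //; exists (tau e).
Qed.

End image_kernel.

Section lebesgue_invariance.
Context {R : realType}.
Local Notation mu := (@lebesgue_measure R).

Lemma lebesgue_measure_translation (h : R) (A : set (measurableTypeR R)) :
  measurable A -> mu ((fun x => x + h) @^-1` A) = mu A.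
Proof.
have mf : measurable_fun [set: measurableTypeR R]
  (fun x => x + h : measurableTypeR R) by exact: measurable_funD.
move=> mA; apply/esym.
suff : mu A = image_measure mu _ mf A by [].
apply: lebesgue_measure_unique => // _ [[a b]] _ <-.
rewrite image_measureE (_ : _ @^-1` _ = `]a - h, b - h]%classic).
  by rewrite [LHS]lebesgue_measure_itv [RHS]lebesgue_measure_itv/=
    !lte_fin ltrD2r -!EFinB opprB addrA subrK.
by apply/seteqP; split => x /=; rewrite !in_itv/= ltrBlDr lerBrDr.
Qed.

Lemma lebesgue_measure_reflection (c : R) (A : set (measurableTypeR R)) :
  measurable A -> mu ((fun x => c - x) @^-1` A) = mu A.
Proof.
have mf : measurable_fun [set: measurableTypeR R]
  (fun x => c - x : measurableTypeR R) by exact: measurable_funB.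
move=> mA; apply/esym.
suff : mu A = image_measure mu _ mf A by [].
apply: lebesgue_measure_unique => // _ [[a b]] _ <-.
(* The reflection exchanges the open and the closed end, with the length unchanged. *)
rewrite image_measureE (_ : _ @^-1` _ = `[c - b, c - a[%classic).
  rewrite [LHS]lebesgue_measure_itv [RHS]lebesgue_measure_itv/=
    !lte_fin ltrD2l ltrN2 -!EFinB opprB.
  by rewrite [c - a + _]addrC addrA subrK.
by apply/seteqP; split => x /=; rewrite !in_itv/= => /andP[? ?];
  apply/andP; split; lra.
Qed.

Context {d} {T : measurableType d} (F : {sigma_finite_measure set T -> \bar R}).

Lemma measurable_map_snd (phi : R -> R) : measurable_fun [set: R] phi ->
  measurable_fun [set: T * measurableTypeR R]
    (fun p => (p.1, phi p.2) : T * measurableTypeR R).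
Proof.
move=> mphi; apply: measurable_fun_pair => //.
exact: (@measurableT_comp _ _ _ _ _ _ phi).
Qed.

(** The image of the product measure agrees with it on rectangles, which characterizes the
    product. *)
Lemma product_lebesgue_invariance (phi : R -> R) (A : set (T * measurableTypeR R)) :
  measurable_fun [set: R] phi ->
  (forall B : set (measurableTypeR R), measurable B -> mu (phi @^-1` B) = mu B) ->
  measurable A ->
  (F \x mu)%E ((fun p => (p.1, phi p.2)) @^-1` A) = (F \x mu)%E A.
Proof.
move=> mphi phi_mu mA; have mtau := measurable_map_snd phi mphi.
apply/esym.
suff : (F \x mu)%E A = image_measure (F \x mu)%E _ mtau A by [].
apply: product_measure_unique => //.
move=> B C mB mC; rewrite image_measureE.
rewrite (_ : _ @^-1` _ = B `*` (phi @^-1` C))// [LHS]product_measure1E//.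
  by congr (_ * _)%E; exact: phi_mu.
by rewrite -[X in measurable X]setTI; exact: mphi.
Qed.

Lemma integral_product_reflection (c : R) (k : T * measurableTypeR R -> \bar R) :
  measurable_fun [set: T * measurableTypeR R] k -> (forall p, 0 <= k p)%E ->
  (\int[F \x mu]_p k (p.1, (c - p.2)%R) = \int[F \x mu]_p k p)%E.
Proof.
move=> mk k0.
have mphi : measurable_fun [set: R] (fun x : R => c - x).
  exact: measurable_funB.
have mtau := measurable_map_snd (fun x => c - x) mphi.
transitivity (\int[image_measure (F \x mu)%E _ mtau]_p k p)%E.
  exact/esym/ge0_integral_image_measure.
apply: (eq_measure_integral (F \x mu)%E) => A mA _.
apply: (product_lebesgue_invariance (fun x => c - x)) => //.
exact: lebesgue_measure_reflection.
Qed.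

End lebesgue_invariance.

(** * Measurability of droplet trajectories *)

Section left_continuous.
Context {d} {X : measurableType d} {R : realType}.

(* The largest [k] with [k / n.+1 < a], for [a] positive. *)
Let left_index (n : nat) (a : R) : nat := `|Num.ceil (a * n.+1%:R)|%N.-1.

Let left_grid (n : nat) (a : R) : R := (left_index n a)%:R / n.+1%:R.

Let left_indexP (n : nat) (a : R) : 0 < a ->
  (left_index n a)%:R < a * n.+1%:R <= (left_index n a).+1%:R.
Proof.
move=> a0; have c0 : (0 < Num.ceil (a * n.+1%:R))%R.
  by rewrite ceil_gt0 mulr_gt0.
have cE : Num.ceil (a * n.+1%:R) = (left_index n a).+1%:Z.
  by rewrite /left_index prednK ?absz_gt0 ?gt_eqF// gtz0_abs.
by have := ceil_itv (a * n.+1%:R); rewrite cE -addn1 PoszD addrK.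
Qed.

Let left_index_unique (n k : nat) (a : R) :
  k%:R < a * n.+1%:R <= k.+1%:R -> left_index n a = k.
Proof.
move=> /andP[ka ak]; have a0 : 0 < a.
  by rewrite -(@pmulr_lgt0 _ n.+1%:R)// (le_lt_trans _ ka).
have /andP[la al] := left_indexP n a a0.
apply/eqP; rewrite eqn_leq -ltnS -(ltr_nat R) (lt_le_trans la ak)/=.
by rewrite -ltnS -(ltr_nat R) (lt_le_trans ka al).
Qed.

Let left_grid_lt n a : 0 < a -> left_grid n a < a.
Proof. by move=> /(left_indexP n)/andP[? _]; rewrite ltr_pdivrMr. Qed.

Let left_grid_cvg a : 0 < a -> left_grid n a @[n --> \oo] --> a.
Proof.
move=> a0; apply: (@squeeze_cvgr _ _ _ _ (fun n => a - n.+1%:R^-1) (cst a)).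
- apply: nearW => n; apply/andP; split; last exact/ltW/left_grid_lt.
  have /andP[_] := left_indexP n a a0.
  rewrite /left_grid -ler_pdivlMr// -natr1 mulrDl mul1r => h.
  by rewrite lerBlDr.
- rewrite -[X in _ --> X]subr0; apply: cvgB; first exact: cvg_cst.
  exact: cvg_harmonic.
- exact: cvg_cst.
Qed.

(** [h] is the pointwise limit of its values at the grid point just to the left. On the strip of
    ages in ]k/(n+1), (k+1)/(n+1)] that point is constantly k/(n+1), so measurability at fixed ages
    is enough; k = 0 is where age 0 enters. *)
Lemma measurable_left_continuous (D : set X) (h : X -> R -> R) :
  measurable D ->
  (forall a, 0 <= a -> measurable_fun D (h ^~ a)) ->
  (forall x a, D x -> 0 < a -> h x b @[b --> a^'-] --> h x a) ->
  measurable_fun (D `*` `]0, +oo[ : set (X * R)) (fun p => h p.1 p.2).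
Proof.
move=> mD mh lch.
apply: (@measurable_fun_cvg _ _ _ _
  (fun n p => h p.1 (left_grid n p.2))) => [n|[x a] [/= Dx]].
  move=> _ B mB; rewrite (_ : _ `&` _ = \bigcup_k
     ((D `&` (h ^~ (k%:R / n.+1%:R)) @^-1` B) `*`
      `](k%:R / n.+1%:R), (k.+1%:R / n.+1%:R)])).
    apply: bigcup_measurable => k _; apply: measurableX => //.
    by apply: mh => //; rewrite divr_ge0.
  apply/seteqP; split => [[x a] /= [[Dx]]|[x a] [k _ /= [[Dx Bx]]]].
    rewrite in_itv/= andbT => a0 Bx; exists (left_index n a) => //=.
    split=> //; rewrite in_itv/= ltr_pdivrMr// ler_pdivlMr//.
    exact: left_indexP.
  rewrite !in_itv/= ltr_pdivrMr// ler_pdivlMr// => ka.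
  rewrite /left_grid (left_index_unique n k a)//; split => //; split => //.
  rewrite andbT -(@pmulr_lgt0 _ n.+1%:R)//.
  by case/andP: ka => ka _; rewrite (le_lt_trans _ ka).
rewrite in_itv/= andbT => a0.
(* Grid points stay strictly below [a], as convergence along the left filter requires. *)
apply: (@cvg_comp _ _ _ (fun n => left_grid n a) (h x) _ (a^'-)); last exact: lch.
move=> A /= [e e0 eA]; near=> n; apply: eA => /=; last exact: left_grid_lt.
by near: n; move/cvgrPdist_lt : (left_grid_cvg a a0); apply.
Unshelve. all: by end_near. Qed.

End left_continuous.

Section droplet_measurability.
Context {R : realType}.

Let left_cvg_cutoff (u : R -> R) (zeta : \bar R) (t : R) : 0 < t ->
  {within [set x : R | 0 <= x /\ (x%:E <= zeta)%E], continuous u} ->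
  ((zeta < t%:E)%E -> exists2 t0, t0 < t & forall s, t0 <= s -> u s = 0) ->
  u x @[x --> t^'-] --> u t.
Proof.
move=> t0 /subspace_continuousP cu u0.
have [tz|zt] := leP (t%:E) zeta.
  have := cu t; move=> /(_ (conj (ltW t0) tz)); apply: cvg_trans.
  apply: cvg_app => A [e /= e0 eA].
  (* Distance less than [t] keeps [x] positive, hence in the set on which [u] is continuous. *)
  exists (Num.min e t) => /=; first by rewrite lt_min e0 t0.
  move=> x /=; rewrite lt_min => /andP[xe xt] xltt; apply: eA => //=.
  split; last by rewrite (le_trans _ tz)// lee_fin ltW.
  by move: xt; rewrite gtr0_norm ?subr_gt0//; lra.
have [s st us] := u0 zt; rewrite us; last exact: ltW.
apply: cvg_near_cst; exists (t - s) => /=; first by rewrite subr_gt0.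
move=> x /= xs xt; apply/us.
by move: xs; rewrite gtr0_norm ?subr_gt0//; lra.
Qed.

(* A trajectory is continuous up to its duration and vanishes afterwards; it
   may only jump just after its duration. *)
Lemma droplet_left_continuous (r : R) (z q : R -> R) : droplet r z q ->
  forall t : R, 0 < t ->
  (z x @[x --> t^'-] --> z t) /\ (q x @[x --> t^'-] --> q t).
Proof.
move=> zq t t0.
have gone : (duration z q < t%:E)%E ->
    exists2 s, s < t & forall x, s <= x -> z x = 0 /\ q x = 0.
  move=> /ereal_inf_lt[_ [s /= [s0 zqs] <-]]; rewrite lte_fin => st.
  exists s => // x sx; case: zqs => [zs|qs].
    exact: (droplet_landed zq s0 zs sx).
  by have [-> ->] := droplet_evaporated zq s0 qs sx.
split.
  apply: (left_cvg_cutoff _ (duration z q)) => //.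
    exact: droplet_height_continuous zq.
  by move=> /gone[s st zqs]; exists s => // x /zqs[].
apply: (left_cvg_cutoff _ (duration z q)) => //.
  exact: droplet_radius_continuous zq.
by move=> /gone[s st zqs]; exists s => // x /zqs[].
Qed.

Lemma measurable_family (hgt rad : R -> R -> R) : droplet_family hgt rad ->
  measurable_fun (`]0, +oo[ `*` `]0, +oo[ : set (R * R))
    (fun p => hgt p.1 p.2) /\
  measurable_fun (`]0, +oo[ `*` `]0, +oo[ : set (R * R))
    (fun p => rad p.1 p.2).
Proof.
move=> fam.
have lc r t : `]0, +oo[%classic r -> 0 < t ->
    (hgt r x @[x --> t^'-] --> hgt r t) /\ (rad r x @[x --> t^'-] --> rad r t).
  rewrite /= in_itv/= andbT => r0.
  exact: droplet_left_continuous (family_droplet fam r0) t.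
split; apply: measurable_left_continuous => //.
- exact: family_height_measurable fam.
- by move=> r t Dr t0; case: (lc r t Dr t0).
- exact: family_radius_measurable fam.
- by move=> r t Dr t0; case: (lc r t Dr t0).
Qed.

End droplet_measurability.

(** * The sea spray process *)

Section covariance.
Context {d} {T : measurableType d} {R : realType} (P : probability T R).
Local Open Scope ereal_scope.

(* The product of the centered variables need not be integrable; its negative
   part is, being at most [b * x + a * y]. *)
Let integral_centered_mul_EFin (x y : T -> R) (a b : R) (C : \bar R) :
  measurable_fun [set: T] x -> measurable_fun [set: T] y ->
  (forall o, 0 <= x o)%R -> (forall o, 0 <= y o)%R -> 0 <= C ->
  \int[P]_o (x o)%:E = a%:E -> \int[P]_o (y o)%:E = b%:E ->
  \int[P]_o (x o * y o)%:E = C + (a * b)%:E ->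
  \int[P]_o ((x o - a) * (y o - b))%:E = C.
Proof.
move=> mx my x0 y0 C0 Ex Ey Exy.
have a0 : (0 <= a)%R.
  by rewrite -lee_fin -Ex; apply: integral_ge0 => o _; rewrite lee_fin.
have b0 : (0 <= b)%R.
  by rewrite -lee_fin -Ey; apply: integral_ge0 => o _; rewrite lee_fin.
pose phi o := ((x o - a) * (y o - b))%R.
have mphi : measurable_fun setT phi.
  by apply: measurable_funM; exact: measurable_funB.
(* The centered product [phi] is [U - V] with both terms nonnegative. Integrating U + phi^- = phi^+
   + V avoids any +oo - +oo; [V] has finite integral 2ab, so phi^- can be cancelled, even when [C]
   is +oo. *)
pose V o := (b * x o + a * y o)%R; pose U o := (x o * y o + a * b)%R.
have mV : measurable_fun setT V by apply: measurable_funD; exact: measurable_funM.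
have mU : measurable_fun setT U.
  by apply: measurable_funD => //; exact: measurable_funM.
have V0 o : (0 <= V o)%R by rewrite addr_ge0// mulr_ge0.
have U0 o : (0 <= U o)%R by rewrite addr_ge0// mulr_ge0.
have IV : \int[P]_o (V o)%:E = (a * b + a * b)%:E.
  under eq_integral do rewrite EFinD !EFinM.
  rewrite ge0_integralD//; do ?[by move=> o _; rewrite -EFinM lee_fin mulr_ge0];
    do ?[by apply/measurable_EFinP; exact: measurable_funM].
  rewrite !ge0_integralZl//; do ?[by move=> o _; rewrite lee_fin];
    do ?[exact/measurable_EFinP].
  by rewrite Ex Ey -!EFinM -EFinD mulrC.
have IU : \int[P]_o (U o)%:E = C + (a * b + a * b)%:E.
  under eq_integral do rewrite EFinD.
  rewrite ge0_integralD//; do ?[by move=> o _; rewrite lee_fin mulr_ge0];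
    do ?[by apply/measurable_EFinP; exact: measurable_funM].
  rewrite Exy integral_cst// [X in _ * X]probability_setT mule1.
  by rewrite -addeA -EFinD.
have mphip : measurable_fun setT (EFin \o phi)^\+.
  by apply: measurable_funepos; exact/measurable_EFinP.
have mphin : measurable_fun setT (EFin \o phi)^\-.
  by apply: measurable_funeneg; exact/measurable_EFinP.
have UV : \int[P]_o (U o)%:E + \int[P]_o (EFin \o phi)^\- o =
    \int[P]_o (EFin \o phi)^\+ o + \int[P]_o (V o)%:E.
  rewrite -!ge0_integralD//; do ?[by move=> o _; rewrite lee_fin];
    do ?[exact/measurable_EFinP].
  apply: eq_integral => o _; rewrite funeposE funenegE/=.
  rewrite -!EFin_max -!EFinD; congr EFin.
  have -> : U o = (phi o + V o)%R by rewrite /U /V /phi; ring.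
  by rewrite /Order.max; case: ifPn; case: ifPn; lra.
have nV : \int[P]_o (EFin \o phi)^\- o <= \int[P]_o (V o)%:E.
  apply: ge0_le_integral => //; first exact/measurable_EFinP.
  move=> o _; rewrite funenegE/= -EFin_max lee_fin ge_max V0 andbT.
  by rewrite lerNl /phi /V; have := U0 o; rewrite /U; nra.
rewrite integralE -/phi.
have n0 : 0 <= \int[P]_o (EFin \o phi)^\- o by exact: integral_ge0.
have p0 : 0 <= \int[P]_o (EFin \o phi)^\+ o by exact: integral_ge0.
move: UV nV n0 p0; rewrite IU IV; rewrite -/phi.
have -> : (fun o => ((x o - a) * (y o - b))%:E) = EFin \o phi by [].
move: (\int[P]_o (EFin \o phi)^\+ o) (\int[P]_o (EFin \o phi)^\- o).
move=> [p| |] [n| |]//; case: C C0 {Exy IU} => [c| |]// c0.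
by rewrite -!EFinD => -[h] _ _ _; congr EFin; lra.
Qed.

(** Finite means make [X] and [Y] almost surely finite, so they may be replaced by their real parts,
    for which centering is ordinary subtraction. *)
Lemma integral_centered_mul (X Y : T -> \bar R) (C : \bar R) :
  measurable_fun [set: T] X -> measurable_fun [set: T] Y ->
  (forall o, 0 <= X o) -> (forall o, 0 <= Y o) -> 0 <= C ->
  \int[P]_o X o < +oo -> \int[P]_o Y o < +oo ->
  \int[P]_o (X o * Y o) = C + (\int[P]_o X o) * (\int[P]_o Y o) ->
  \int[P]_o ((X o - \int[P]_o X o) * (Y o - \int[P]_o Y o)) = C.
Proof.
move=> mX mY X0 Y0 C0 X_lty Y_lty XY.
have ae_fin (Z : T -> \bar R) : measurable_fun [set: T] Z ->
    (forall o, 0 <= Z o) -> \int[P]_o Z o < +oo ->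
    ae_eq P [set: T] Z (fun o => (fine (Z o))%:E).
  move=> mZ Z0 Z_lty; have : P.-integrable setT Z.
    apply/integrableP; split => //.
    by under eq_integral do rewrite gee0_abs//.
  move=> /(integrable_ae measurableT); apply: filterS => o /(_ Logic.I) h _.
  by rewrite fineK.
have mfine (Z : T -> \bar R) : measurable_fun [set: T] Z ->
    measurable_fun [set: T] (fun o => fine (Z o)).
  by move=> mZ; exact: measurableT_comp.
have aX := ae_fin X mX X0 X_lty; have aY := ae_fin Y mY Y0 Y_lty.
have fX := mfine X mX; have fY := mfine Y mY.
have eX : \int[P]_o (fine (X o))%:E = \int[P]_o X o.
  by apply/esym/ae_eq_integral => //; exact/measurable_EFinP.
have eY : \int[P]_o (fine (Y o))%:E = \int[P]_o Y o.
  by apply/esym/ae_eq_integral => //; exact/measurable_EFinP.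
have Xfin : \int[P]_o X o = (fine (\int[P]_o X o))%:E.
  by rewrite fineK// ge0_fin_numE//; exact: integral_ge0.
have Yfin : \int[P]_o Y o = (fine (\int[P]_o Y o))%:E.
  by rewrite fineK// ge0_fin_numE//; exact: integral_ge0.
rewrite Xfin Yfin.
rewrite -[RHS](integral_centered_mul_EFin (fun o => fine (X o))
  (fun o => fine (Y o)) (fine (\int[P]_o X o)) (fine (\int[P]_o Y o)))//.
- apply: ae_eq_integral => //.
  + by apply: emeasurable_funM; exact: emeasurable_funB.
  + apply/measurable_EFinP; apply: measurable_funM; exact: measurable_funB.
  + apply: filterS2 aX aY => o Xo Yo _.
    by rewrite Xo// Yo// -!EFinB -EFinM.
- by move=> o; rewrite fine_ge0.
- by move=> o; rewrite fine_ge0.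
- by rewrite eX.
- by rewrite eY.
- rewrite EFinM -Xfin -Yfin -XY; apply: ae_eq_integral => //.
  + by apply/measurable_EFinP; exact: measurable_funM.
  + exact: emeasurable_funM.
  + by apply: filterS2 aX aY => o Xo Yo _; rewrite EFinM -Xo// -Yo.
Qed.

End covariance.

Lemma integral_patch_setX {d d'} {X : measurableType d} {Y : measurableType d'}
    {R : realType} (mu : {measure set X -> \bar R})
    (nu : {measure set Y -> \bar R}) (A : set X) (B : set Y)
    (k : X * Y -> \bar R) :
  (\int[nu]_y \int[mu]_x (k \_ (A `*` B)) (x, y) =
   \int[nu]_(y in B) \int[mu]_(x in A) k (x, y))%E.
Proof.
rewrite [RHS]integral_mkcond; apply: eq_integral => y _.
rewrite [RHS]patchE; case: ifPn => [/set_mem By|/negP yB].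
  rewrite [RHS]integral_mkcond; apply: eq_integral => x _; rewrite !patchE.
  by rewrite in_setX/= (mem_set By) andbT.
rewrite integral0_eq// => x _; rewrite patchE in_setX/=.
by rewrite (negbTE (introN idP yB)) andbF.
Qed.

(** * Mass of a single droplet as a function of initial radius and age *)

Section spray_mass.
Context {R : realType} (hgt rad : R -> R -> R).
Local Open Scope ereal_scope.

(** Extension by 0 discards the meaningless values at negative ages and lets every integral run over
    the whole product space, where the reflection acts. *)
Definition droplet_mass (z : R) : R * R -> \bar R :=
  (fun p => (rad p.1 p.2 ^+ 3 * \1_`]0%R, z] (hgt p.1 p.2))%:E)
    \_ (`]0%R, +oo[ `*` `[0%R, +oo[).

Lemma droplet_massE (z r a : R) : (0 < r)%R -> (0 <= a)%R ->
  droplet_mass z (r, a) = (rad r a ^+ 3 * \1_`]0%R, z] (hgt r a))%:E.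
Proof.
move=> r0 a0; rewrite /droplet_mass patchE mem_set//=.
by rewrite !in_itv/= r0 a0.
Qed.

Lemma droplet_mass0 (z r a : R) : ~ ((0 < r)%R /\ (0 <= a)%R) ->
  droplet_mass z (r, a) = 0.
Proof.
move=> ra; rewrite /droplet_mass patchE memNset//= => -[].
by rewrite /= !in_itv/= !andbT => r0 a0; exact: ra.
Qed.

Hypothesis fam : droplet_family hgt rad.

Lemma droplet_mass_ge0 (z : R) p : 0 <= droplet_mass z p.
Proof.
case: p => r a; have [[r0 a0]|ra] := pselect ((0 < r)%R /\ (0 <= a)%R).
  rewrite droplet_massE// lee_fin mulr_ge0// exprn_ge0//.
  exact: (droplet_radius_ge0 (family_droplet fam r0)).
by rewrite droplet_mass0.
Qed.

(* A droplet of age [0] is at height [0], hence has no mass in ]0, z]. *)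
Let droplet_mass_positive_age (z : R) : droplet_mass z =
  (fun p => (rad p.1 p.2 ^+ 3 * \1_`]0%R, z] (hgt p.1 p.2))%:E)
    \_ (`]0%R, +oo[ `*` `]0%R, +oo[).
Proof.
apply/funext => -[r a]; rewrite /droplet_mass !patchE.
have [[r0 a0]|ra] := pselect ((0 < r)%R /\ (0 < a)%R).
  by rewrite !mem_set//= !in_itv/= r0 ?a0 ?ltW.
rewrite [in RHS]memNset; last first.
  by move=> /= -[]; rewrite !in_itv/= !andbT => r0 a0; exact: ra.
case: ifPn => // /set_mem/= []; rewrite !in_itv/= !andbT => r0 a0.
have -> : a = 0%R.
  apply/eqP; rewrite eq_le a0 andbT leNgt; apply/negP => a_gt0.
  exact: ra.
rewrite (droplet_height0 (family_droplet fam r0)).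
by rewrite indicE memNset ?mulr0//= in_itv/= ltxx.
Qed.

Lemma measurable_droplet_mass (z : R) :
  measurable_fun [set: measurableTypeR R * measurableTypeR R] (droplet_mass z).
Proof.
have [mh mq] := measurable_family _ _ fam.
have mD : measurable (`]0%R, +oo[ `*` `]0%R, +oo[ :
    set (measurableTypeR R * measurableTypeR R)) by exact: measurableX.
(* Left limits give joint measurability at positive ages only, so age 0 has to be removed from the
   domain. *)
rewrite droplet_mass_positive_age; apply/(measurable_restrictT _ mD).
apply/measurable_EFinP; apply: measurable_funM; first exact: measurable_funX.
apply: measurableT_comp mh; exact: measurable_indic.
Qed.

End spray_mass.

(** * Mean, second moment and stationarity of the spray *)

Section sea_spray.
Context {R : realType} (rho : R) (hgt rad : R -> R -> R).
Hypotheses (rho0 : 0 < rho) (fam : droplet_family hgt rad).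
Local Open Scope ereal_scope.

Let RR : measurableType _ := (measurableTypeR R * measurableTypeR R)%type.
Let c : R := (4 / 3 * pi * rho)%R.

Let c0 : (0 <= c)%R.
Proof. by rewrite !mulr_ge0// ?pi_ge0 ?ltW. Qed.

(* Mass at time [t], below height [z], of a droplet with initial radius [p.1]
   and ejection time [p.2]. *)
Definition spray_mass (t z : R) (p : R * R) : \bar R :=
  droplet_mass hgt rad z (p.1, t - p.2)%R.

Lemma spray_mass_ge0 t z p : 0 <= spray_mass t z p.
Proof. exact: droplet_mass_ge0. Qed.

Lemma measurable_spray_mass t z : measurable_fun [set: RR] (spray_mass t z).
Proof.
have mphi : measurable_fun [set: R] (fun x : R => t - x)%R.
  exact: measurable_funB.
exact: measurableT_comp (measurable_droplet_mass hgt rad fam z)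
  (measurable_map_snd _ mphi).
Qed.

Lemma sea_sprayE (nu : {measure set RR -> \bar R}) (t z : R) :
  sea_spray rho hgt rad nu t z = c%:E * \int[nu]_p spray_mass t z p.
Proof.
congr (_ * _); rewrite [LHS]integral_mkcond; apply: eq_integral => -[r s] _.
rewrite patchE /spray_mass/=; case: ifPn => [/set_mem/= []|/negP rs].
  rewrite !in_itv/= andbT => r0 st.
  by rewrite droplet_massE// subr_ge0.
rewrite droplet_mass0// => -[r0]; rewrite subr_ge0 => st.
by apply: rs; rewrite inE/= !in_itv/= r0 st.
Qed.

(** With the constant absorbed, the process is the integral of one nonnegative function, the form in
    which Campbell's formulas and the equality in law apply. *)
Let sea_spray_integral (nu : {measure set RR -> \bar R}) (t z : R) :
  sea_spray rho hgt rad nu t z = \int[nu]_p (c%:E * spray_mass t z p).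
Proof.
rewrite sea_sprayE ge0_integralZl// ?lee_fin//.
- exact: measurable_spray_mass.
- by move=> p _; exact: spray_mass_ge0.
Qed.

Let measurable_scaled_mass t z :
  measurable_fun [set: RR] (fun p => c%:E * spray_mass t z p).
Proof. by apply: measurable_funeM; exact: measurable_spray_mass. Qed.

Let scaled_mass_ge0 t z p : 0 <= c%:E * spray_mass t z p.
Proof. by rewrite mule_ge0 ?lee_fin// spray_mass_ge0. Qed.

Context (F : {finite_measure set (measurableTypeR R) -> \bar R}).
Local Notation mu := (@lebesgue_measure R).
Let Lambda : {measure set RR -> \bar R} := (F \x mu).

Let integral_Lambda (a : R) (k : R * R -> \bar R) :
  measurable_fun [set: RR] k -> (forall p, 0 <= k p) ->
  \int[Lambda]_p k (p.1, (a - p.2)%R) =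
  \int[mu]_u \int[F]_r k (r, u).
Proof.
move=> mk k0.
transitivity (\int[Lambda]_p k p); first exact: integral_product_reflection.
exact: (@fubini_tonelli2 _ _ _ _ _ F mu k mk k0).
Qed.

Lemma integral_spray_mass (t z : R) :
  \int[Lambda]_p spray_mass t z p =
  \int[mu]_(u in `[0%R, +oo[) \int[F]_(r in `]0%R, +oo[)
    (rad r u ^+ 3 * \1_`]0%R, z] (hgt r u))%:E.
Proof.
rewrite (integral_Lambda t (droplet_mass hgt rad z)).
- exact: integral_patch_setX.
- exact: measurable_droplet_mass.
- exact: droplet_mass_ge0.
Qed.

Lemma integral_spray_mass_mul (t z s w : R) :
  \int[Lambda]_p (spray_mass t z p * spray_mass s w p) =
  \int[mu]_(u in `[0%R, +oo[) \int[F]_(r in `]0%R, +oo[)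
    (rad r (t - Num.min s t + u) ^+ 3 * rad r (s - Num.min s t + u) ^+ 3 *
     \1_`]0%R, z] (hgt r (t - Num.min s t + u)) *
     \1_`]0%R, w] (hgt r (s - Num.min s t + u)))%:E.
Proof.
(* The variable [u = a - v] is the age, at the earlier of the two times, of a droplet ejected at
   [v]; its ages at [t] and [s] are then [t - a + u] and [s - a + u]. *)
pose a := Num.min s t.
pose k (p : R * R) : \bar R := droplet_mass hgt rad z (p.1, t - a + p.2)%R *
  droplet_mass hgt rad w (p.1, s - a + p.2)%R.
transitivity (\int[Lambda]_p k (p.1, (a - p.2)%R)).
  apply: eq_integral => p _; rewrite /k /spray_mass/=.
  by rewrite !addrA !subrK.
rewrite integral_Lambda; last 2 first.
- apply: emeasurable_funM.
    have mphi : measurable_fun [set: R] (fun x : R => t - a + x)%R.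
      exact: measurable_funD.
    exact: measurableT_comp (measurable_droplet_mass hgt rad fam z)
      (measurable_map_snd _ mphi).
  have mphi : measurable_fun [set: R] (fun x : R => s - a + x)%R.
    exact: measurable_funD.
  exact: measurableT_comp (measurable_droplet_mass hgt rad fam w)
    (measurable_map_snd _ mphi).
- by move=> p; rewrite mule_ge0// droplet_mass_ge0.
apply: etrans (integral_patch_setX F mu `]0%R, +oo[ `[0%R, +oo[ (fun p : R * R =>
  (rad p.1 (t - a + p.2) ^+ 3 * rad p.1 (s - a + p.2) ^+ 3 *
   \1_`]0%R, z] (hgt p.1 (t - a + p.2)) *
   \1_`]0%R, w] (hgt p.1 (s - a + p.2)))%:E)).
apply: eq_integral => u _.
apply: eq_integral => r _; rewrite patchE /k/=.
have at0 : (0 <= t - a)%R by rewrite subr_ge0 ge_min lexx orbT.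
have as0 : (0 <= s - a)%R by rewrite subr_ge0 ge_min lexx.
case: ifPn => [/set_mem/= []|/negP ru].
  rewrite !in_itv/= !andbT => r0 u0.
  have tu0 : (0 <= t - a + u)%R by apply: addr_ge0.
  have su0 : (0 <= s - a + u)%R by apply: addr_ge0.
  rewrite !droplet_massE// -EFinM; congr EFin.
  by ring.
have [rpos|rneg] := pselect (0 < r)%R; last by rewrite droplet_mass0 ?mul0e// => -[].
have u0 : (u < 0)%R.
  by rewrite ltNge; apply/negP => u0; apply: ru; rewrite inE/= !in_itv/= rpos u0.
(* For negative [u] the droplet is not yet ejected at the earlier time, so the factor belonging to
   that time, whose age is [u] itself, vanishes. *)
have [st|ts] := leP s t.
  rewrite [X in _ * X]droplet_mass0 ?mule0// /a (min_idPl st) subrr add0r.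
  by move=> []; rewrite leNgt u0.
rewrite droplet_mass0 ?mul0e// /a (min_idPr (ltW ts)) subrr add0r.
by move=> []; rewrite leNgt u0.
Qed.

Context {d} {Omega : measurableType d} {P : probability Omega R}.
Context {N : R.-ker Omega ~> RR}.
Hypothesis hN : poisson_point_process P Lambda N.

Lemma measurable_sea_spray (t z : R) :
  measurable_fun [set: Omega] (fun o => sea_spray rho hgt rad (N o) t z).
Proof.
under eq_fun do rewrite sea_spray_integral.
exact: measurable_integral_ppp.
Qed.

Lemma sea_spray_ge0 (t z : R) o : 0 <= sea_spray rho hgt rad (N o) t z.
Proof. by rewrite sea_spray_integral; exact: integral_ge0. Qed.

Lemma sea_spray_mean (t z : R) :
  \int[P]_o sea_spray rho hgt rad (N o) t z =
  c%:E * \int[Lambda]_p spray_mass t z p.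
Proof.
rewrite (_ : (fun o => _) = fun o => \int[N o]_p (c%:E * spray_mass t z p));
  last by apply/funext => o; rewrite sea_spray_integral.
rewrite (campbell_mean hN)// ge0_integralZl// ?lee_fin//.
- exact: measurable_spray_mass.
- by move=> p _; exact: spray_mass_ge0.
Qed.

Lemma sea_spray_second_moment (t z s w : R) :
  \int[P]_o
    (sea_spray rho hgt rad (N o) t z * sea_spray rho hgt rad (N o) s w) =
  (c ^+ 2)%:E * \int[Lambda]_p (spray_mass t z p * spray_mass s w p) +
  (\int[P]_o sea_spray rho hgt rad (N o) t z) *
  (\int[P]_o sea_spray rho hgt rad (N o) s w).
Proof.
have SE t' z' : (fun o => sea_spray rho hgt rad (N o) t' z') =
    fun o => \int[N o]_p (c%:E * spray_mass t' z' p).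
  by apply/funext => o; rewrite sea_spray_integral.
transitivity (\int[P]_o (\int[N o]_p (c%:E * spray_mass t z p) *
    \int[N o]_p (c%:E * spray_mass s w p))).
  by apply: eq_integral => o _; rewrite -!sea_spray_integral.
rewrite (campbell_second_moment hN)//; congr (_ + _ * _).
- under eq_integral do rewrite muleACA -EFinM -expr2.
  rewrite ge0_integralZl// ?lee_fin ?sqr_ge0//.
    by apply: emeasurable_funM; exact: measurable_spray_mass.
  by move=> p _; rewrite mule_ge0// spray_mass_ge0.
- by rewrite SE (campbell_mean hN).
- by rewrite SE (campbell_mean hN).
Qed.

Lemma sea_spray_stationary :
  stationary_process P (fun t z o => sea_spray rho hgt rad (N o) t z).
Proof.
split=> [t z _|n t z h _ B mB]; first exact: measurable_sea_spray.
(* Ejecting every droplet earlier by [h] turns its age at time [t] into its former age at [t + h],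
   so the spray of the shifted process at [t] is the original spray at [t + h]. *)
have mphi : measurable_fun [set: R] (fun x : R => x - h)%R.
  exact: measurable_funB.
have mtau := measurable_map_snd (T := measurableTypeR R) _ mphi.
have hN' : poisson_point_process P Lambda (image_kernel N _ mtau).
  apply: ppp_image hN => A mA.
  apply: (product_lebesgue_invariance F (fun x => x - h)%R) => // C mC.
  exact: lebesgue_measure_translation.
pose f (i : 'I_n) p := c%:E * spray_mass (t i) (z i) p.
have mf i : measurable_fun [set: RR] (f i) by exact: measurable_scaled_mass.
have f0 i p : 0 <= f i p by exact: scaled_mass_ge0.
have := ppp_integrals_law hN' hN n f B mf f0 mB.
have -> : [set o | B [tuple \int[image_kernel N _ mtau o]_p f i p | i < n]] =
    [set o | B [tuple sea_spray rho hgt rad (N o) (t i + h) (z i) | i < n]].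
  apply/funext => o; congr (B _); apply: eq_mktuple => i.
  rewrite sea_spray_integral.
  rewrite (ge0_integral_image_measure _ _ mtau (f i) (mf i) (f0 i)).
  by apply: eq_integral => p _; rewrite /f /spray_mass/= opprB addrA.
move=> ->; congr (P _); apply/funext => o; congr (B _).
by apply: eq_mktuple => i; rewrite sea_spray_integral.
Qed.

End sea_spray.

Theorem theorem3p4 (R : realType) (rho : R) (hrho : 0 < rho)
    (F : {finite_measure set (measurableTypeR R) -> \bar R})
    (hF : F `]-oo, 0]%classic = 0%E)
    (hgt rad : R -> R -> R) (hfam : droplet_family hgt rad)
    (d : measure_display) (Omega : measurableType d) (P : probability Omega R)
    (N : R.-ker Omega ~> (measurableTypeR R * measurableTypeR R)%type)
    (hN : poisson_point_process P (F \x (@lebesgue_measure R))%E N) :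
  let S := fun (t z : R) (o : Omega) => sea_spray rho hgt rad (N o) t z in
  let m := fun z : R => ((4 / 3 * pi * rho)%:E *
    \int[@lebesgue_measure R]_(s in `[0%R, +oo[) \int[F]_(r in `]0%R, +oo[)
      (rad r s ^+ 3 * \1_`]0, z] (hgt r s))%:E)%E in
  let sigma2 := fun t z s w : R =>
    (\int[P]_o ((S t z o - m z) * (S s w o - m w)))%E in
  [/\ stationary_process P S,
      forall t z : R, 0 < z -> (\int[P]_o S t z o)%E = m z,
      forall t z s w : R, 0 < z -> 0 < w ->
        (m z < +oo)%E -> (m w < +oo)%E ->
        sigma2 t z s w = ((16 / 9 * pi ^+ 2 * rho ^+ 2)%:E *
          \int[@lebesgue_measure R]_(u in `[0%R, +oo[) \int[F]_(r in `]0%R, +oo[)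
            (rad r (t - Num.min s t + u) ^+ 3 *
             rad r (s - Num.min s t + u) ^+ 3 *
             \1_`]0, z] (hgt r (t - Num.min s t + u)) *
             \1_`]0, w] (hgt r (s - Num.min s t + u)))%:E)%E
    & forall t z w : R, 0 < z -> 0 < w ->
        (m z < +oo)%E -> (m w < +oo)%E ->
        sigma2 t z t w = ((16 / 9 * pi ^+ 2 * rho ^+ 2)%:E *
          \int[@lebesgue_measure R]_(u in `[0%R, +oo[) \int[F]_(r in `]0%R, +oo[)
            (rad r u ^+ 6 * \1_`]0, Num.min z w] (hgt r u))%:E)%E ].
Proof.
move=> S m sigma2.
pose Lambda : {measure set _ -> \bar R} := (F \x (@lebesgue_measure R))%E.
(* The intensity is restated as a bundled measure, the form used by the Poisson lemmas. *)
have {}hN : poisson_point_process P Lambda N by [].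
have mean t z : (\int[P]_o S t z o)%E = m z.
  rewrite [LHS](sea_spray_mean rho hgt rad hrho hfam F hN).
  by rewrite /m -(integral_spray_mass hgt rad hfam F t).
have cov t z s w : (m z < +oo)%E -> (m w < +oo)%E -> sigma2 t z s w =
    ((16 / 9 * pi ^+ 2 * rho ^+ 2)%:E *
      \int[@lebesgue_measure R]_(u in `[0%R, +oo[) \int[F]_(r in `]0%R, +oo[)
        (rad r (t - Num.min s t + u) ^+ 3 *
         rad r (s - Num.min s t + u) ^+ 3 *
         \1_`]0, z] (hgt r (t - Num.min s t + u)) *
         \1_`]0, w] (hgt r (s - Num.min s t + u)))%:E)%E.
  move=> mz mw; have Sz : (\int[P]_o S t z o < +oo)%E.
    by rewrite (mean t z); exact: mz.
  have Sw : (\int[P]_o S s w o < +oo)%E by rewrite (mean s w); exact: mw.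
  rewrite /sigma2 -(mean t z) -(mean s w).
  have -> : 16 / 9 * pi ^+ 2 * rho ^+ 2 = (4 / 3 * pi * rho) ^+ 2 by field.
  rewrite -(integral_spray_mass_mul hgt rad hfam F).
  apply: (integral_centered_mul P (S t z) (S s w)).
  - exact: (measurable_sea_spray rho hgt rad hrho hfam).
  - exact: (measurable_sea_spray rho hgt rad hrho hfam).
  - by move=> o; exact: (sea_spray_ge0 rho hgt rad hrho hfam).
  - by move=> o; exact: (sea_spray_ge0 rho hgt rad hrho hfam).
  - rewrite mule_ge0// ?lee_fin ?sqr_ge0//.
    by apply: integral_ge0 => p _; rewrite mule_ge0// spray_mass_ge0.
  - exact: Sz.
  - exact: Sw.
  - exact: (sea_spray_second_moment rho hgt rad hrho hfam F hN).
split=> //.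
- exact: (sea_spray_stationary rho hgt rad hrho hfam F hN).
- by move=> t z s w _ _; exact: cov.
- move=> t z w _ _ mz mw; rewrite (cov t z t w mz mw); congr (_ * _)%E.
  apply: eq_integral => u _; apply: eq_integral => r _; congr EFin.
  (* At equal times both shifts vanish, and the two indicators multiply to that of the intersection
     of ]0, z] and ]0, w]. *)
  rewrite minxx subrr add0r -exprD -mulrA; congr (_ * _).
  rewrite !indicE -natrM mulnb; congr (_%:R); congr nat_of_bool.
  apply/andP/idP; rewrite !inE/= !in_itv/= le_min.
    by move=> [/andP[-> ->] /andP[_ ->]].
  by move=> /andP[-> /andP[-> ->]].
Qed.
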